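(* Let $d_n(\varepsilon)$ denote the largest (supremal) Manhattan distance between two bodies of volume $\varepsilon\in(0,\frac12)$ in the unit cube $[0,1]^n$. Then for every $\varepsilon\in(0,\frac12)$ $$\lim_{n\to\infty}\frac{d_n(\varepsilon)}{\sqrt n}=-2\sqrt{\frac{\pi}{6}}\,\Phi^{-1}(\varepsilon).$$ The function $-2\sqrt{\frac{\pi}{6}}\,\Phi^{-1}(\varepsilon)$ is asymptotically equivalent to $\frac{2}{\sqrt6}\sqrt{-\ln\varepsilon}$ as $\varepsilon\to0^+$ (the ratio tends to $1$).
   Context: $\Phi(a)=\int_{-\infty}^{a}e^{-\pi x^2}\,dx$, an increasing bijection $\mathbb{R}\to(0,1)$, and $\Phi^{-1}$ is its inverse. The Manhattan distance between points is $d(x,y)=\sum_{i=1}^n|x_i-y_i|$, and between non-empty sets $d(A,B)=\inf_{x\in A,\,y\in B}d(x,y)$. Bodies are measurable subsets of $[0,1]^n$; volume is Lebesgue measure; $d_n(\varepsilon)$ is the supremum of $d(A,B)$ over bodies $A,B\subseteq[0,1]^n$ of volume exactly $\varepsilon$. *)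

(* Defs.v *)
From HB Require Import structures.
From mathcomp Require Import all_boot all_order all_algebra.
From mathcomp Require Import all_classical all_reals all_analysis.

Set Implicit Arguments.
Unset Strict Implicit.
Unset Printing Implicit Defensive.

Import Order.TTheory GRing.Theory Num.Theory.
Import numFieldNormedType.Exports.

Local Open Scope classical_set_scope.
Local Open Scope ring_scope.

(* R^n; [n.-tuple _] carries the Borel (product) sigma-algebra. *)
Definition Rn (R : realType) (n : nat) := n.-tuple (measurableTypeR R).

Definition Rcons (R : realType) (n : nat) (p : measurableTypeR R * Rn R n) :
  Rn R n.+1 := [the n.+1.-tuple (measurableTypeR R) of p.1 :: p.2].

Lemma measurable_Rcons (R : realType) (n : nat) :
  measurable_fun [set: measurableTypeR R * Rn R n] (@Rcons R n).
Proof. by apply: measurable_cons. Qed.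

Section product_step.
Context (R : realType) (n : nat) (m : {measure set (Rn R n) -> \bar R}).
Local Open Scope ereal_scope.

Definition product_step : set (Rn R n.+1) -> \bar R :=
  pushforward (product_measure2 (@lebesgue_measure R) m) (@Rcons R n).

Let product_step0 : product_step set0 = 0.
Proof. by rewrite /product_step /pushforward preimage_set0 measure0. Qed.

Let product_step_ge0 A : 0 <= product_step A.
Proof. by rewrite /product_step /pushforward measure_ge0. Qed.

Let product_step_sigma_additive : semi_sigma_additive product_step.
Proof.
apply: (@measure_semi_sigma_additive _ _ _
  (pushforward (product_measure2 (@lebesgue_measure R) m) (@Rcons R n))).
exact: measurable_Rcons.
Qed.

HB.instance Definition _ := isMeasure.Build _ _ _ product_step
  product_step0 product_step_ge0 product_step_sigma_additive.

End product_step.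

(* The n-fold product of the Lebesgue measure of the line, on Borel sets;
   R^0 is one point, of mass 1. *)
Fixpoint borel_lebesgue (R : realType) (n : nat) :
    {measure set (Rn R n) -> \bar R} :=
  match n with
  | 0 => dirac ([tuple] : Rn R 0)
  | m.+1 => product_step (borel_lebesgue R m)
  end.

(* Lebesgue measure on R^n is the completion of the previous measure: the
   outer measure it generates, on its Caratheodory-measurable sets. *)
Definition vol (R : realType) (n : nat) : set (Rn R n) -> \bar R :=
  ((borel_lebesgue R n)^*)%mu.

Definition lebesgue_measurable (R : realType) (n : nat) (A : set (Rn R n)) :
  Prop := ((borel_lebesgue R n)^*)%mu.-caratheodory A.

Definition cube (R : realType) (n : nat) : set (Rn R n) :=
  [set x | forall i : 'I_n, (0 : R) <= tnth x i <= 1].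
Arguments cube : clear implicits.

Definition body (R : realType) (n : nat) (A : set (Rn R n)) : Prop :=
  lebesgue_measurable A /\ A `<=` cube R n.

Definition manhattan (R : realType) (n : nat) (x y : Rn R n) : R :=
  \sum_(i < n) `|tnth x i - tnth y i : R|.

Definition set_dist (R : realType) (n : nat) (A B : set (Rn R n)) : R :=
  inf [set manhattan x y | x in A & y in B].

(* For 0 < eps < 1 and n > 0 this is the supremum of a non-empty set of reals
   between 0 and n (a set of positive volume is non-empty). *)
Definition max_dist (R : realType) (n : nat) (eps : R) : R :=
  sup [set r | exists A B : set (Rn R n),
    [/\ body A, body B, vol A = eps%:E, vol B = eps%:E & r = set_dist A B]].

Definition Phi (R : realType) (a : R) : R :=
  \int[lebesgue_measure]_(x in `]-oo, a]) expR (- pi * x ^+ 2).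

(* The inverse of Phi, meaningful on its range ]0, 1[. *)
Definition Phi_inv (R : realType) : R -> R := pinv [set: R] (@Phi R).

(* Main.v *)
From HB Require Import structures.
Require Import Defs.
From mathcomp Require Import all_boot all_order all_algebra.
From mathcomp Require Import all_classical all_reals all_analysis.
From mathcomp Require Import measurable_realfun ring lra.

(** The extremal pairs are opposite corner half-spaces [x_1 + .. + x_n <= b] and
    [x_1 + .. + x_n >= c], at Manhattan distance [c - b].  The sum of [n]
    independent uniform coordinates has variance [n / 12], that is [n * (pi / 6)]
    times the variance [1 / (2 * pi)] of the normal law with distribution function
    [Phi].  By the central limit theorem the half-spaces of volume [eps] lie at
    [n / 2 + sqrt n * sqrt (pi / 6) * Phi_inv eps] and at the symmetric level,
    which gives the lower bound ([max_dist_lower]).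

    The upper bound is an isoperimetric inequality: under Manhattan enlargement,
    corner half-spaces grow slowest.  It is proved for smoothed indicators.  Let
    [G0] be a Gaussian distribution function with density [g0], and let
    [G_n s] be the mean of [G0 (s - (x_1 + .. + x_n))] over the cube, with
    density [g_n].  If [f] is nonexpansive for the Manhattan metric and the mean
    of [G0 \o f] is [G_n r], then the mean of [g0 \o f] is at least [g_n r]
    ([functional_isoperimetry]).  Slicing in one coordinate reduces this to an
    inequality on the unit interval ([one_dim_isoperimetry]), which rests on the
    concavity of [g_n \o G_n^-1], preserved by convolution with the uniform law
    ([profile_window]).  Integrating along [f + c] shows that the mean of
    [G0 (f + t)] is at least [G_n (r + t)] ([isoperimetry]).  Applied to
    [h - dist(x, A)], this bounds the distance of two bodies of volume [eps]
    ([separated_bodies]); the smoothing has width [d * sqrt n] and costs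
    [h = eta * sqrt n], where [d] and [eta] may be taken arbitrarily small.

    Both bounds need [G_n] to be asymptotically Gaussian.  As [Phi (w / sqrt t)]
    solves a heat equation in [w] and [t], replacing the uniform coordinates one
    by one by Gaussian increments gives this with an explicit error
    ([uniform_smoothing_clt]).

    The behaviour near [0] follows from
    [gauss (a + 1) <= Phi (- a) <= gauss a] for [a >= 1]. *)

Set Implicit Arguments.
Unset Strict Implicit.
Unset Printing Implicit Defensive.

Import Order.TTheory GRing.Theory Num.Theory.
Import numFieldNormedType.Exports.

Local Open Scope classical_set_scope.
Local Open Scope ring_scope.

(** * Calculus on the line and means over the unit interval *)

Section calculus.
Context {R : realType}.
Implicit Types (f g F : R -> R) (a b x y : R).

Lemma is_derive_continuous f (df : R -> R) :
  (forall x, is_derive x 1 f (df x)) -> continuous f.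
Proof.
move=> h x; apply: differentiable_continuous; apply/derivable1_diffP.
exact: (@ex_derive _ _ _ _ _ _ _ (h x)).
Qed.

Lemma mean_value_in f (df : R -> R) a b :
  (forall x : R, a <= x <= b -> is_derive x 1 f (df x)) ->
  a <= b -> exists2 c, a <= c <= b & f b - f a = df c * (b - a).
Proof.
move=> h ab.
have cf : {within `[a, b], continuous f}.
  apply: derivable_within_continuous => x; rewrite in_itv/= => /h hx.
  exact: (@ex_derive _ _ _ _ _ _ _ hx).
have hi (x : R) : x \in `]a, b[ -> is_derive x 1 f (df x).
  by rewrite in_itv/= => /andP[ax xb]; apply: h; rewrite !ltW.
have [c] := @MVT_segment R f df a b ab hi cf.
by rewrite in_itv/= => cab e; exists c.
Qed.

Lemma mean_value f (df : R -> R) a b : (forall x, is_derive x 1 f (df x)) ->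
  a <= b -> exists2 c, a <= c <= b & f b - f a = df c * (b - a).
Proof. by move=> h; apply: mean_value_in => x _; exact: h. Qed.

Lemma nondecreasing_of_derive f (df : R -> R) a b :
  (forall x, is_derive x 1 f (df x)) ->
  a <= b -> (forall x, a <= x <= b -> 0 <= df x) -> f a <= f b.
Proof.
move=> h ab dp; have [c cab e] := mean_value h ab.
by rewrite -subr_ge0 e mulr_ge0 ?subr_ge0// dp.
Qed.

Lemma continuous_delta f x e : continuous f -> 0 < e ->
  exists2 d, 0 < d & forall y, `|y - x| < d -> `|f y - f x| < e.
Proof.
move=> /(_ x) /cvgrPdist_lt /(_ e) cf /cf /nbhs_ballP[d /= d0 h].
by exists d => // y yx; rewrite distrC; apply: h; rewrite /ball/= distrC.
Qed.

(** Consider the supremum of the points [y] of the segment with [f a <= f y]: the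
    local hypothesis on its left shows that it is such a point, and on its right
    that it is [b]. *)
Lemma locally_nondecreasing f a b : a <= b ->
  (forall x, a <= x <= b -> exists2 d, 0 < d & forall y, a <= y <= b ->
     `|y - x| < d -> 0 <= (f y - f x) * (y - x)) ->
  f a <= f b.
Proof.
move=> ab loc.
pose S := [set y | a <= y <= b /\ f a <= f y].
have Sa : S a by split; rewrite ?lexx.
have ubS : ubound S b by move=> y [/andP[]].
have supS : has_sup S by split; [exists a | exists b].
set s := sup S.
have as_ : a <= s by apply: ub_le_sup => //; exists b.
have sb : s <= b by apply: ge_sup => //; exists a.
have [|d d0 locd] := loc s; first by rewrite as_.
have Ss : f a <= f s.
  have [y [/andP[ay yb] fay] sdy] := sup_adherent d0 supS.
  have ys : y <= s by apply: ub_le_sup; [exists b | split => //; rewrite ay].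
  apply: le_trans fay _.
  move: ys; rewrite le_eqVlt => /predU1P[->//|ys].
  rewrite -/s in sdy.
  have := locd y; rewrite ay yb => /(_ isT); rewrite ltr0_norm ?subr_lt0//.
  have -> : - (y - s) < d by lra.
  move=> /(_ isT); rewrite nmulr_lge0 ?subr_lt0//; lra.
move: sb; rewrite le_eqVlt => /predU1P[<-//|sb].
pose y := Num.min b (s + d / 2).
have sy : s < y by rewrite lt_min sb/=; lra.
have yb : y <= b by rewrite ge_min lexx.
have ay : a <= y by exact: le_trans as_ (ltW sy).
have ysd : y <= s + d / 2 by rewrite ge_min lexx orbT.
have := locd y; rewrite ay yb => /(_ isT); rewrite gtr0_norm ?subr_gt0//.
have -> : y - s < d by lra.
move=> /(_ isT); rewrite pmulr_lge0 ?subr_gt0// subr_ge0 => fsy.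
have : y <= s.
  apply: ub_le_sup; first by exists b.
  by split; [rewrite yb ay | exact: le_trans fsy].
lra.
Qed.

(** Adding the linear function [e * x] makes the local hypothesis of
    [locally_nondecreasing] exact, and [e] is arbitrary.  This applies to
    functions which are only known to be Lipschitz. *)
Lemma nondecreasing_of_dini f a b : a <= b ->
  (forall x e, a <= x <= b -> 0 < e -> exists2 d, 0 < d &
     forall y, a <= y <= b -> `|y - x| < d ->
       0 <= (f y - f x + e * (y - x)) * (y - x)) ->
  f a <= f b.
Proof.
move=> ab loc; apply/ler_addgt0Pr => e e0.
pose e' := e / (b - a + 1).
have e'0 : 0 < e' by rewrite divr_gt0//; lra.
have fab : f a + e' * a <= f b + e' * b.
  apply: (@locally_nondecreasing (fun x => f x + e' * x)) => // x xab.
  have [d d0 h] := loc x _ xab e'0; exists d => // y yab /(h _ yab).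
  by congr (0 <= _ * _); ring.
have : e' * (b - a) <= e.
  rewrite /e' mulrAC ler_pdivrMr; last lra.
  by rewrite ler_pM2l//; lra.
lra.
Qed.

Definition unit_mean f : R := \int[lebesgue_measure]_(x in `[0, 1]) f x.

Lemma continuous_integrable f a b : continuous f ->
  lebesgue_measure.-integrable `[a, b] (EFin \o f).
Proof.
move=> cf; apply: continuous_compact_integrable; first exact: segment_compact.
exact: continuous_subspaceT.
Qed.

Lemma unit_mean_derive F f : (forall x, is_derive x 1 F (f x)) -> continuous f ->
  unit_mean f = F 1 - F 0.
Proof.
move=> dF cf.
have cF := is_derive_continuous dF.
rewrite /unit_mean /Rintegral (@continuous_FTC2 R f F 0 1)//.
- exact: continuous_subspaceT.
- split.
  + by move=> x _; exact: (@ex_derive _ _ _ _ _ _ _ (dF x)).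
  + exact: cvg_at_right_filter (cF 0).
  + exact: cvg_at_left_filter (cF 1).
- by move=> x _; rewrite derive1E; exact: (@derive_val _ _ _ _ _ _ _ (dF x)).
Qed.

(** The difference of the two integrals is the oriented integral from [0] to [x],
    one of them being zero. *)
Lemma continuous_antiderivative f : continuous f ->
  exists F, forall x, is_derive x 1 F (f x).
Proof.
move=> cf; pose J a b : R := \int[lebesgue_measure]_(x in `[a, b]) f x.
exists (fun x => J 0 x - J x 0) => x.
pose a := Num.min x 0 - 1; pose u := Num.max x 0 + 1.
have ax : a < x by rewrite /a; have : Num.min x 0 <= x by [rewrite ge_min lexx]; lra.
have a0 : a < 0 by rewrite /a; have : Num.min x 0 <= 0 by [rewrite ge_min lexx orbT]; lra.
have xu : x < u by rewrite /u; have : x <= Num.max x 0 by [rewrite le_max lexx]; lra.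
have [] := @continuous_FTC1_closed R f a x u xu _ ax (cf x).
  exact: continuous_integrable.
move=> dJ J'.
have split3 p q : a <= p -> p <= q -> J a q - J a p = J p q.
  move=> ap pq; rewrite /J (@Rintegral_itvB R f (BLeft a) (BRight q) p).
  - by rewrite Rintegral_itv_obnd_cbnd//; apply: integrableS (continuous_integrable p q cf) => //;
      apply: subset_itvr; rewrite bnd_simp.
  - exact: continuous_integrable.
  - by rewrite bnd_simp.
  - by rewrite bnd_simp.
have Jab p q : q <= p -> p != q -> J p q = 0.
  move=> qp pq; rewrite /J set_itv_ge ?Rintegral_set0// bnd_simp -ltNge.
  by rewrite lt_neqAle eq_sym pq.
have J0 p : J p p = 0 by rewrite /J set_itv1 Rintegral_set1.
have E y : a < y -> J 0 y - J y 0 = J a y - J a 0.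
  move=> ay; case: (ltgtP y 0) => [y0|y0|->].
  - rewrite (Jab 0 y) ?(ltW y0)// ?gt_eqF// sub0r -(split3 y 0) ?(ltW y0) ?(ltW ay)//.
    by rewrite opprB.
  - rewrite (Jab y 0) ?(ltW y0)// ?gt_eqF// subr0 -(split3 0 y) ?(ltW y0) ?(ltW a0)//.
  - by rewrite J0 !subrr.
rewrite derive1E in J'; have dJ0 : is_derive x 1 (J a) (f x) := DeriveDef dJ J'.
have dJ1 : is_derive x 1 (fun y => J a y - J a 0) (f x).
  have -> : f x = f x - 0 by rewrite subr0.
  exact: is_deriveB.
apply: near_eq_is_derive dJ1.
near=> y; apply/esym/E; near: y.
exact: lt_nbhsr.
Unshelve. all: by end_near. Qed.

Lemma unit_mean_le f g : continuous f -> continuous g ->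
  (forall x, 0 <= x <= 1 -> f x <= g x) -> unit_mean f <= unit_mean g.
Proof.
by move=> cf cg fg; apply: le_Rintegral => //; exact: continuous_integrable.
Qed.

Lemma unit_meanD f g : continuous f -> continuous g ->
  unit_mean (fun x => f x + g x) = unit_mean f + unit_mean g.
Proof. by move=> cf cg; apply: RintegralD => //; exact: continuous_integrable. Qed.

Lemma unit_meanZ k f : continuous f -> unit_mean (fun x => k * f x) = k * unit_mean f.
Proof. by move=> cf; apply: RintegralZl => //; exact: continuous_integrable. Qed.

Lemma unit_mean_cst k : unit_mean (fun=> k) = k.
Proof.
rewrite /unit_mean Rintegral_cst//=.
by rewrite lebesgue_measure_itv/= lte_fin ltr01/= subr0 mulr1.
Qed.

Lemma unit_mean_dist (f g : R -> R) c : continuous f -> continuous g ->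
  (forall x, 0 <= x <= 1 -> `|f x - g x| <= c) -> `|unit_mean f - unit_mean g| <= c.
Proof.
move=> cf cg h.
have cc : continuous (fun _ : R => c) by move=> ?; exact: cvg_cst.
have h1 : unit_mean f <= unit_mean g + c.
  rewrite -[X in _ + X](unit_mean_cst c) -unit_meanD//; apply: unit_mean_le => //.
    by move=> x; apply: cvgD; [exact: cg|exact: cc].
  by move=> x /h; rewrite ler_norml => /andP[]; lra.
have h2 : unit_mean g <= unit_mean f + c.
  rewrite -[X in _ + X](unit_mean_cst c) -unit_meanD//; apply: unit_mean_le => //.
    by move=> x; apply: cvgD; [exact: cf|exact: cc].
  by move=> x /h; rewrite ler_norml => /andP[]; lra.
by rewrite ler_norml; apply/andP; split; lra.
Qed.

End calculus.

(** * Log-concave profiles *)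

Section profile.
Context {R : realType}.
Implicit Types (G g dg : R -> R) (a b x y r : R).

(** [G] has the log-concave density [g], with derivative [dg]: the last field says
    that [dg / g] is nonincreasing, or that the isoperimetric profile [g \o G^-1],
    the boundary of a half-line as a function of its mass, is concave. *)
Record profile G g dg : Prop := Profile {
  profile_derive : forall x, is_derive x 1 G (g x);
  profile_derive2 : forall x, is_derive x 1 g (dg x);
  profile_gt0 : forall x, 0 < g x;
  profile_log_concave : forall a b, a <= b -> dg b * g a <= dg a * g b }.

Section theory.
Variables (G g dg : R -> R) (P : profile G g dg).

Lemma profile_ltr a b : a < b -> G a < G b.
Proof.
move=> ab; have [c _ e] := mean_value (profile_derive P) (ltW ab).
by rewrite -subr_gt0 e mulr_gt0 ?subr_gt0// (profile_gt0 P).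
Qed.

Lemma profile_ler a b : a <= b -> G a <= G b.
Proof. by rewrite le_eqVlt => /predU1P[->//|/profile_ltr/ltW]. Qed.

Lemma profile_lt a b : (G a < G b) = (a < b).
Proof.
case: (ltP a b) => ab; first exact: profile_ltr.
by apply/negbTE; rewrite -leNgt; exact: profile_ler.
Qed.

Lemma profile_le a b : (G a <= G b) = (a <= b).
Proof. by rewrite !leNgt profile_lt. Qed.

Lemma profile_inj a b : G a = G b -> a = b.
Proof. by move=> e; apply/eqP; rewrite eq_le -(profile_le a b) -(profile_le b a) e lexx. Qed.

(** In the coordinate [G] the profile has slope [dg / g], which is nonincreasing:
    [g - (dg b / g b) * G] increases up to [b] and decreases afterwards. *)
Lemma profile_tangent b v : g v <= g b + dg b / g b * (G v - G b).
Proof.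
pose B := dg b / g b.
have dD x : is_derive x 1 (fun x => g x - B * G x) (dg x - B * g x).
  have d1 := profile_derive P x; have d2 := profile_derive2 P x.
  have d3 := is_deriveZ B d1; exact: is_deriveB.
have gb := profile_gt0 P b.
have key x : dg x - B * g x = (dg x * g b - dg b * g x) / g b.
  by rewrite /B; field; rewrite gt_eqF.
have [vb|/ltW bv] := leP v b.
  suff : g v - B * G v <= g b - B * G b by rewrite -/B; lra.
  apply: nondecreasing_of_derive vb _ => // x /andP[_ xb].
  rewrite key divr_ge0 ?(ltW gb)// subr_ge0.
  exact: (profile_log_concave P).
suff : - (g b - B * G b) <= - (g v - B * G v) by rewrite -/B; lra.
apply: (@nondecreasing_of_derive _ (fun x => - (g x - B * G x)) _ b v
  (fun x => is_deriveN (dD x)) bv) => x /andP[bx _].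
rewrite key -mulNr divr_ge0 ?(ltW gb)// opprB subr_ge0.
exact: (profile_log_concave P).
Qed.

(** The tangent at [b] has a slope between those of the two chords. *)
Lemma profile_slope a b c : a <= b -> b <= c ->
  (g c - g b) * (G b - G a) <= (g b - g a) * (G c - G b).
Proof.
move=> ab bc.
have := profile_tangent b a; have := profile_tangent b c.
set B := dg b / g b => hc ha.
have Gab := profile_ler ab; have Gbc := profile_ler bc.
apply: (@le_trans _ _ (B * (G c - G b) * (G b - G a))).
  by apply: ler_wpM2r; lra.
rewrite mulrAC; apply: ler_wpM2r; lra.
Qed.

(** The line is the chord of the profile from [m] to [M], or its tangent when
    [m = M].  It is the comparison function of the one-dimensional inequality. *)
Lemma profile_chord m M : m <= M -> exists A B,
  (forall v, m <= v <= M -> 0 < A + B * G v /\ A + B * G v <= g v) /\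
  (forall v, v <= m \/ M <= v -> g v <= A + B * G v).
Proof.
rewrite le_eqVlt => /predU1P[<-|mM].
  exists (g m - dg m / g m * G m), (dg m / g m).
  have gm := profile_gt0 P m.
  split => v.
    by move=> /andP[h h']; have -> : v = m by [lra]; lra.
  by move=> _; have := profile_tangent m v; lra.
have GmM := profile_ltr mM.
have d0 : 0 < G M - G m by rewrite subr_gt0.
pose B := (g M - g m) / (G M - G m).
have BE : B * (G M - G m) = g M - g m by rewrite /B divfK// gt_eqF.
exists (g m - B * G m), B.
have gm := profile_gt0 P m; have gM := profile_gt0 P M.
split => v.
  move=> /andP[mv vM].
  have h1 := profile_ler mv; have h2 := profile_ler vM.
  split.
    rewrite -(pmulr_lgt0 _ d0).
    have -> : (g m - B * G m + B * G v) * (G M - G m) =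
      g m * (G M - G v) + g M * (G v - G m).
      have -> : g M = g m + B * (G M - G m) by rewrite BE; ring.
      ring.
    case: (ltP (G m) (G v)) => h3; first nra.
    have : g m * (G M - G v) > 0 by rewrite mulr_gt0//; lra.
    have : g M * (G v - G m) >= 0 by rewrite mulr_ge0//; lra.
    lra.
  rewrite -(ler_pM2r d0).
  have -> : (g m - B * G m + B * G v) * (G M - G m) =
      g m * (G M - G m) + (g M - g m) * (G v - G m) by rewrite -BE; ring.
  have := profile_slope mv vM; nra.
move=> h; rewrite -(ler_pM2r d0).
have -> : (g m - B * G m + B * G v) * (G M - G m) =
      g m * (G M - G m) + (g M - g m) * (G v - G m) by rewrite -BE; ring.
case: h => h.
  have := profile_slope h (ltW mM); nra.
have := profile_slope (ltW mM) h; nra.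
Qed.

Lemma profile_cont : continuous G. Proof. exact: is_derive_continuous (profile_derive P). Qed.
Lemma profile_cont2 : continuous g. Proof. exact: is_derive_continuous (profile_derive2 P). Qed.

Lemma is_derive_window (Q q : R -> R) : (forall x, is_derive x 1 Q (q x)) ->
  forall x, is_derive x 1 (fun s => Q s - Q (s - 1)) (q x - q (x - 1)).
Proof.
move=> dQ x; apply: is_deriveB.
have h : is_derive x (1 : R) (fun s : R => s - 1) (1 : R).
  by rewrite -[X in is_derive _ _ _ X]subr0; apply: is_deriveB.
have := @is_derive1_comp R Q (fun s => s - 1) x _ _ (dQ (x - 1)) h.
by rewrite mulr1.
Qed.

(** Convolution with the uniform law of the unit interval keeps log-concavity: the
    new ratio is the slope of the chord of the old profile between [x - 1] and [x],
    and this slope decreases when the window moves to the right. *)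
Lemma profile_window (Q : R -> R) : (forall x, is_derive x 1 Q (G x)) ->
  profile (fun s => Q s - Q (s - 1)) (fun s => G s - G (s - 1))
    (fun s => g s - g (s - 1)).
Proof.
move=> dQ; split.
- exact: is_derive_window.
- exact: is_derive_window (profile_derive P).
- by move=> x; rewrite subr_gt0 profile_lt; lra.
move=> a b; rewrite le_eqVlt => /predU1P[->|ab]; first by rewrite lexx.
have s1 : (g b - g a) * (G a - G (a - 1)) <= (g a - g (a - 1)) * (G b - G a).
  by apply: profile_slope; lra.
have s2 : (g b - g (b - 1)) * (G (b - 1) - G (a - 1)) <=
          (g (b - 1) - g (a - 1)) * (G b - G (b - 1)).
  by apply: profile_slope; lra.
have X0 : G (a - 1) < G a by apply: profile_ltr; lra.
have Z0 : G (b - 1) < G b by apply: profile_ltr; lra.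
have S0 : 0 < G b - G (a - 1) by have := profile_ltr ab; lra.
rewrite -(ler_pM2r S0).
apply: (@le_trans _ _ ((g b - g (a - 1)) * (G b - G (b - 1)) * (G a - G (a - 1)))).
  rewrite [leLHS]mulrAC ler_pM2r; lra.
rewrite [leLHS]mulrAC [leRHS]mulrAC ler_pM2r; lra.
Qed.

End theory.
End profile.

(** * The one-dimensional inequality *)

Section one_dim.
Context {R : realType}.
Variables (G g dg Q u W a : R -> R) (C r : R).
Hypothesis P : profile G g dg.
Hypothesis dQ : forall x : R, is_derive x 1 Q (G x).
Hypotheses (cu : continuous u) (cW : continuous W) (C0 : 0 <= C).
Hypothesis uE : forall x, u x = G (a x).
Hypothesis gW : forall x, g (a x) <= W x.
Hypothesis uW : forall x y, `|u y - u x| <= W x * `|y - x| + C * (y - x) ^+ 2.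

Section local.
Variables (A B : R) (Z : R -> R) (sg : R).
Hypothesis dZ : forall x : R, is_derive x 1 Z (W x - (A + B * u x)).
Hypothesis sg1 : `|sg| = 1.
Let T v := G v - (A * v + B * Q v).

Lemma is_derive_excess (v : R) : is_derive v 1 T (g v - (A + B * G v)).
Proof.
have hA : is_derive v 1 (fun v : R => A * v) A.
  by rewrite -[X in is_derive _ _ _ X](mulr1 A); exact: (is_deriveZ A (is_derive_id v 1)).
have hB := is_deriveZ B (dQ v).
have hD := is_deriveD hA hB.
have hG := profile_derive P v.
exact: is_deriveB.
Qed.

Let cT' : continuous (fun v => g v - (A + B * G v)).
Proof.
move=> v; apply: cvgB; first exact: profile_cont2 P v.
apply: cvgD; first exact: cvg_cst.
by apply: cvgM; [exact: cvg_cst | exact: profile_cont P v].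
Qed.

(** The infinitesimal estimate is [W - l >= (1 - l / g) * W >= (1 - l / g) * |u'|],
    where [l = A + B * u] and [(1 - l / g) * u'] is the derivative of [T] along [a].
    As [a] need not be differentiable, it is stated in Dini form, with a sign [sg]
    to bound the variation of [T] from both sides. *)
Lemma excess_local x e : 0 < e ->
  0 < A + B * u x -> A + B * u x <= g (a x) ->
  exists2 d, 0 < d & forall y, `|y - x| < d ->
    0 <= (Z y + sg * T (a y) - (Z x + sg * T (a x)) + e * (y - x)) * (y - x).
Proof.
move=> e0; rewrite uE; set p := a x; set l := A + B * G p => l0 lg.
have gp := profile_gt0 P p.
have Wx0 : 0 < W x by exact: lt_le_trans gp (gW x).
(* [e] pays for [eta * W x], for the variation of the derivative of [Z] and for the
   quadratic term of [uW], a quarter each *)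
pose eta := e / (4 * (W x + 1)).
have eta0 : 0 < eta by rewrite divr_gt0//; lra.
have etaW : eta * W x <= e / 4.
  have -> : eta * W x = e / 4 * (W x / (W x + 1)) by rewrite /eta; field; lra.
  rewrite ler_piMr//; first lra.
  by rewrite ler_pdivrMr; lra.
pose w := 1 - l / g p.
have w0 : 0 <= w by rewrite subr_ge0 ler_pdivrMr// mul1r.
have wg : w * g p = g p - l by rewrite /w; field; lra.
have w1 : w <= 1 by rewrite /w gerBl divr_ge0//; lra.
have wW : w * W x <= W x - l.
  rewrite /w mulrBl mul1r lerB//.
  rewrite mulrAC ler_pdivlMr//; have := gW x; rewrite -/p; nra.
pose D v := g v - (A + B * G v).
have Dp : D p = w * g p by rewrite wg.
(* near [p], the excess [T] moves at most [w + eta] times as fast as [G] *)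
have [d1 d10 Td1] : exists2 d1, 0 < d1 & forall v, `|v - p| < d1 ->
    `|T v - T p| <= (w + eta) * `|G v - G p|.
  have h0 : 0 < eta * g p by rewrite mulr_gt0.
  have cf1 : continuous (fun v => (w + eta) * g v - D v).
    move=> v; apply: cvgB; last exact: cT'.
    by apply: cvgM; [exact: cvg_cst | exact: profile_cont2 P v].
  have cf2 : continuous (fun v => (w + eta) * g v + D v).
    move=> v; apply: cvgD; last exact: cT'.
    by apply: cvgM; [exact: cvg_cst | exact: profile_cont2 P v].
  have [da da0 ha] := continuous_delta p cf1 h0.
  have [db db0 hb] := continuous_delta p cf2 h0.
  exists (Num.min da db); first by rewrite lt_min da0.
  have sl v : `|v - p| < Num.min da db -> `|D v| <= (w + eta) * g v.
    rewrite lt_min => /andP[/ha + /hb]; rewrite Dp !ltr_norml => /andP[h1 _] /andP[h2 _].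
    have wgp : 0 <= w * g p by rewrite mulr_ge0// ltW.
    by rewrite ler_norml; apply/andP; split; lra.
  have mono v1 v2 : v1 <= v2 ->
      (forall v, v1 <= v <= v2 -> `|v - p| < Num.min da db) ->
      `|T v2 - T v1| <= (w + eta) * (G v2 - G v1).
    move=> v12 hv.
    have dK (s v : R) : is_derive v 1 (fun z => (w + eta) * G z + s * T z)
        ((w + eta) * g v + s * D v).
      have k1 := is_deriveZ (w + eta) (profile_derive P v).
      have k2 := is_deriveZ s (is_derive_excess v).
      exact: is_deriveD.
    have h s : `|s| = 1 ->
        (w + eta) * G v1 + s * T v1 <= (w + eta) * G v2 + s * T v2.
      move=> s1; apply: (nondecreasing_of_derive (dK s)) => // v /hv /sl hD.
      have : `|s * D v| <= (w + eta) * g v by rewrite normrM s1 mul1r.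
      by rewrite ler_norml => /andP[]; lra.
    have := h 1; rewrite normr1 => /(_ erefl) h1.
    have := h (-1); rewrite normrN1 => /(_ erefl) h2.
    by rewrite ler_norml; apply/andP; split; lra.
  move=> v hv.
  case: (leP p v) => [pv|/ltW vp].
    rewrite [X in _ * X]ger0_norm ?subr_ge0 ?(profile_ler P)//.
    apply: mono => // z /andP[z1 z2]; apply: le_lt_trans hv.
    by rewrite !ger0_norm ?subr_ge0//; lra.
  rewrite distrC [X in _ * X]distrC [X in _ * X]ger0_norm ?subr_ge0 ?(profile_ler P)//.
  apply: mono => // z /andP[z1 z2]; apply: le_lt_trans hv.
  by rewrite !ler0_norm ?subr_le0//; lra.
have [d2 d20 hd2] : exists2 d2, 0 < d2 & forall y, `|y - x| < d2 -> `|a y - p| < d1.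
  pose k := Num.min (G (p + d1 / 2) - G p) (G p - G (p - d1 / 2)).
  have k0 : 0 < k.
    by rewrite lt_min !subr_gt0 !(profile_lt P); apply/andP; split; lra.
  have [d2 d20 h] := continuous_delta x cu k0; exists d2 => // y /h.
  rewrite !uE -/p /k lt_min => /andP[].
  move=> /ltr_normlW h1; rewrite distrC => /ltr_normlW h2.
  have h3 : a y < p + d1 / 2 by rewrite -(profile_lt P); lra.
  have h4 : p - d1 / 2 < a y by rewrite -(profile_lt P); lra.
  by rewrite ltr_norml; apply/andP; split; lra.
have e40 : 0 < e / 4 by lra.
have cZ' : continuous (fun z => W z - (A + B * u z)).
  move=> v; apply: cvgB; first exact: cW.
  apply: cvgD; first exact: cvg_cst.
  by apply: cvgM; [exact: cvg_cst | exact: cu].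
have [d3 d30 hd3] := continuous_delta x cZ' e40.
pose d4 := e / (4 * ((1 + eta) * C + 1)).
have k40 : 0 <= (1 + eta) * C by rewrite mulr_ge0//; lra.
have d40 : 0 < d4 by rewrite divr_gt0//; lra.
have d4C : (1 + eta) * C * d4 <= e / 4.
  have -> : (1 + eta) * C * d4 = e / 4 * ((1 + eta) * C / ((1 + eta) * C + 1)).
    by rewrite /d4; field; lra.
  rewrite ler_piMr//; first lra.
  by rewrite ler_pdivrMr; lra.
exists (Num.min (Num.min d2 d3) d4); first by rewrite !lt_min d20 d30 d40.
move=> y; rewrite !lt_min => /andP[/andP[/hd2 yd2 yd3] yd4].
have hT : `|T (a y) - T p| <= (w + eta) * (W x * `|y - x| + C * (y - x) ^+ 2).
  apply: le_trans (Td1 _ yd2) _; rewrite -uE -[G p]uE.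
  by apply: ler_wpM2l; [lra | exact: uW].
set h := y - x in yd3 yd4 hT *.
have hZ : (W x - l - e / 4) * h ^+ 2 <= (Z y - Z x) * h.
  have main s t : s <= t -> (forall z, s <= z <= t -> `|z - x| <= `|h|) ->
      (W x - l - e / 4) * (t - s) <= Z t - Z s.
    move=> st hz; have [c cst ->] := mean_value dZ st.
    apply: ler_wpM2r; first by rewrite subr_ge0.
    have := hd3 c (le_lt_trans (hz c cst) yd3).
    by rewrite [u x]uE -/p -/l ltr_norml => /andP[]; lra.
  have [xy|/ltW yx] := leP x y.
    have := main _ _ xy; rewrite -/h expr2 mulrA => /(_ _) hh.
    apply: ler_wpM2r; first by rewrite subr_ge0.
    apply: hh => z /andP[z1 z2].
    by rewrite /h !ger0_norm ?subr_ge0//; lra.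
  have hh : (W x - l - e / 4) * (x - y) <= Z x - Z y.
    apply: main => // z /andP[z1 z2].
    by rewrite /h !ler0_norm ?subr_le0//; lra.
  have -> : h = - (x - y) by rewrite /h opprB.
  have : 0 <= x - y by rewrite subr_ge0.
  set k := x - y in hh *; move=> k0.
  rewrite sqrrN mulrN -mulNr opprB expr2 mulrA.
  exact: ler_wpM2r.
have h2 : 0 <= h ^+ 2 by rewrite sqr_ge0.
have hT2 : - ((w + eta) * (W x + C * `|h|) * h ^+ 2) <= sg * (T (a y) - T p) * h.
  have : `|sg * (T (a y) - T p) * h| <= (w + eta) * (W x + C * `|h|) * h ^+ 2.
    rewrite !normrM sg1 mul1r.
    apply: (@le_trans _ _ ((w + eta) * (W x * `|h| + C * h ^+ 2) * `|h|)).
      exact: ler_wpM2r.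
    rewrite -(real_normK (num_real h)) le_eqVlt; apply/orP; left; apply/eqP; ring.
  by rewrite ler_norml => /andP[].
have hC : (w + eta) * (C * `|h|) <= e / 4.
  apply: le_trans d4C.
  rewrite -mulrA; apply: ler_pM => //; [lra|exact: mulr_ge0|lra|].
  by apply: ler_wpM2l => //; exact: ltW.
have fin : 0 <= (W x - l - e / 4 - (w + eta) * (W x + C * `|h|) + e) * h ^+ 2.
  by rewrite mulr_ge0//; lra.
have -> : (Z y + sg * T (a y) - (Z x + sg * T p) + e * h) * h =
   (Z y - Z x) * h + sg * (T (a y) - T p) * h + e * h ^+ 2 by ring.
lra.
Qed.

End local.

(** The extremal case is [a x = r - x].  Let [l = A + B * G] be the chord of the
    profile between the minimum [m] and the maximum [M] of [a].  By [excess_local],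
    the mean of [W] is at least the mean of [l] along [a] plus the integral of
    [g - l] from [m] to [M].  The first term depends on the mean of [u] only, hence
    is the integral of [l] over the window from [r - 1] to [r]; the second is at
    least the integral of [g - l] over this window, because [g - l] is
    nonnegative between [m] and [M] and nonpositive elsewhere. *)
Lemma one_dim_isoperimetry :
  unit_mean u = Q r - Q (r - 1) -> G r - G (r - 1) <= unit_mean W.
Proof.
move=> Iu.
have cu01 : {within `[0, 1], continuous u} by exact: continuous_subspaceT.
have [xm xm01 hm] := EVT_min ler01 cu01.
have [xM xM01 hM] := EVT_max ler01 cu01.
set m := a xm; set M := a xM.
have aS x : 0 <= x <= 1 -> m <= a x <= M.
  move=> x01; rewrite -(profile_le P m) -(profile_le P (a x)) -!uE; apply/andP.
  by split; [apply: hm | apply: hM]; rewrite in_itv.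
have mM : m <= M by have /andP[] := aS xM xM01.
have [A [B [h1 h2]]] := profile_chord P mM.
pose T v := G v - (A * v + B * Q v).
have cZ' : continuous (fun z => W z - (A + B * u z)).
  move=> v; apply: cvgB; first exact: cW.
  apply: cvgD; first exact: cvg_cst.
  by apply: cvgM; [exact: cvg_cst | exact: cu].
have [Z dZ] := continuous_antiderivative cZ'.
have main s x y : `|s| = 1 -> 0 <= x -> x <= y -> y <= 1 ->
    Z x + s * T (a x) <= Z y + s * T (a y).
  move=> s1 x0 xy y1.
  apply: (@nondecreasing_of_dini _ (fun x => Z x + s * T (a x))) => //.
  move=> z e /andP[xz zy] e0.
  have zS : 0 <= z <= 1 by rewrite (le_trans x0 xz) (le_trans zy y1).
  have [l0 lg] := h1 _ (aS z zS).
  rewrite -uE in l0 lg.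
  have [d d0 hd] := excess_local dZ s1 e0 l0 lg.
  by exists d => // t _; exact: hd.
have main2 x y : 0 <= x -> x <= y -> y <= 1 -> `|T (a y) - T (a x)| <= Z y - Z x.
  move=> x0 xy y1.
  have k1 := main 1 x y (normr1 _) x0 xy y1.
  have k2 := main (-1) x y (normrN1 _) x0 xy y1.
  by rewrite ler_norml; apply/andP; split; lra.
have Zmono x y : 0 <= x -> x <= y -> y <= 1 -> Z x <= Z y.
  by move=> x0 xy y1; have := main2 x y x0 xy y1; have := normr_ge0 (T (a y) - T (a x)); lra.
have TZ : T M - T m <= Z 1 - Z 0.
  move: xm01 xM01; rewrite !in_itv/= => /andP[a1 a2] /andP[b1 b2].
  have [c|/ltW c] := leP xm xM.
    have := main2 _ _ a1 c b2; have := Zmono 0 xm (lexx _) a1 a2.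
    have := Zmono xM 1 b1 b2 (lexx _); rewrite ler_norml => + + /andP[_]; rewrite -/m -/M; lra.
  have := main2 _ _ b1 c a2; have := Zmono 0 xM (lexx _) b1 b2.
  have := Zmono xm 1 a1 a2 (lexx _); rewrite ler_norml => + + /andP[+ _]; rewrite -/m -/M; lra.
have ZE : Z 1 - Z 0 = unit_mean W - (A + B * (Q r - Q (r - 1))).
  rewrite -(unit_mean_derive dZ cZ') -Iu.
  have cBu : continuous (fun z => B * u z).
    by move=> v; apply: cvgM; [exact: cvg_cst | exact: cu].
  have cl : continuous (fun z => A + B * u z).
    by move=> v; apply: cvgD; [exact: cvg_cst | exact: cBu].
  rewrite -unit_meanZ// -[X in _ = _ - (X + _)](unit_mean_cst A) -unit_meanD//; last exact: cst_continuous.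
  have := @unit_meanD R (fun z => W z - (A + B * u z)) (fun z => A + B * u z) cZ' cl.
  under [X in unit_mean X = _]eq_fun do rewrite subrK.
  by move=> ->; rewrite addrK.
have dT' v := is_derive_excess A B v.
have up x y : x <= y -> m <= x -> y <= M -> T x <= T y.
  move=> xy mx yM; apply: (nondecreasing_of_derive dT') => // v /andP[xv vy].
  by rewrite subr_ge0; have [] := h1 v; rewrite ?(le_trans mx xv) ?(le_trans vy yM).
have down x y : x <= y -> (y <= m \/ M <= x) -> T y <= T x.
  move=> xy hxy; rewrite -lerN2.
  apply: (@nondecreasing_of_derive _ (fun v => - T v) _ x y (fun v => is_deriveN (dT' v)) xy).
  move=> v /andP[xv vy]; rewrite oppr_ge0 subr_le0; apply: h2.
  by case: hxy => h; [left; exact: le_trans vy h | right; exact: le_trans h xv].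
have TmM := up _ _ mM (lexx _) (lexx _).
have r1 : r - 1 <= r by lra.
have key : T r - T (r - 1) <= T M - T m.
  have [rm|/ltW mr] := leP r m; first by have := down _ _ r1 (or_introl rm); lra.
  have [Mr|/ltW rM] := leP M (r - 1); first by have := down _ _ r1 (or_intror Mr); lra.
  have k1 : T r <= T M.
    have [rM'|/ltW Mr] := leP r M; first exact: up.
    by apply: down => //; right.
  have k2 : T m <= T (r - 1).
    have [mr'|/ltW rm] := leP m (r - 1); first exact: up.
    by apply: down => //; left.
  lra.
have TE : T r - T (r - 1) = G r - G (r - 1) - (A + B * (Q r - Q (r - 1))).
  by rewrite /T; ring.
lra.
Qed.

End one_dim.

(** * Iterated means over the cube *)

Section expectation.
Context {R : realType}.

(** An iterated integral, in which slicing in the first coordinate is a computation.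
    On Lipschitz functions it is the integral over the cube, see [integral_cube]. *)
Fixpoint cube_mean n : (Rn R n -> R) -> R :=
  match n with
  | 0 => fun f => f [tuple]
  | m.+1 => fun f => unit_mean (fun x => cube_mean (fun y => f (Rcons (x, y))))
  end.

Definition lipschitz_l1 n (f : Rn R n -> R) :=
  exists2 K : R, 0 <= K & forall x y, `|f x - f y| <= K * manhattan x y.

Lemma manhattan_ge0 n (x y : Rn R n) : 0 <= manhattan x y.
Proof. by apply: sumr_ge0 => i _; exact: normr_ge0. Qed.

Lemma manhattan_Rcons n (x x' : R) (y y' : Rn R n) :
  manhattan (Rcons (x, y)) (Rcons (x', y')) = `|x - x'| + manhattan y y'.
Proof.
rewrite /manhattan big_ord_recl; congr (_ + _); apply: eq_bigr => i _.
by rewrite !tnthS.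
Qed.

Lemma manhattanxx n (x : Rn R n) : manhattan x x = 0.
Proof. by rewrite /manhattan big1// => i _; rewrite subrr normr0. Qed.

Lemma Rcons_cube n (x : R) (y : Rn R n) :
  0 <= x <= 1 -> cube R n y -> cube R n.+1 (Rcons (x, y)).
Proof.
move=> x01 cy i; have [j ->|->] := unliftP ord0 i; last first.
  by rewrite tnth0.
by rewrite tnthS; exact: cy.
Qed.

Lemma lipschitz_cont (u : R -> R) K : (forall x y, `|u x - u y| <= K * `|x - y|) ->
  continuous u.
Proof.
move=> h x; apply/cvgrPdist_lt => e e0.
have K0 : 0 < `|K| + 1 by have := normr_ge0 K; lra.
near=> y; apply: le_lt_trans (h x y) _.
apply: (@le_lt_trans _ _ ((`|K| + 1) * `|x - y|)).
  by apply: ler_wpM2r => //; have := ler_norm K; lra.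
rewrite mulrC -ltr_pdivlMr//; near: y.
by apply: cvgr_dist_lt => //; rewrite divr_gt0.
Unshelve. all: by end_near. Qed.

Lemma lipschitz_l1_slice n (f : Rn R n.+1 -> R) x :
  lipschitz_l1 f -> lipschitz_l1 (fun y => f (Rcons (x, y))).
Proof.
move=> [K K0 h]; exists K => // y y'; apply: le_trans (h _ _) _.
by rewrite manhattan_Rcons subrr normr0 add0r.
Qed.

Lemma lipschitz_l1D n (f g : Rn R n -> R) :
  lipschitz_l1 f -> lipschitz_l1 g -> lipschitz_l1 (fun x => f x + g x).
Proof.
move=> [K K0 h] [L L0 k]; exists (K + L) => [|x y]; first exact: addr_ge0.
rewrite opprD addrACA mulrDl; apply: le_trans (ler_normD _ _) _; exact: lerD.
Qed.

Lemma lipschitz_l1Z n k (f : Rn R n -> R) :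
  lipschitz_l1 f -> lipschitz_l1 (fun x => k * f x).
Proof.
move=> [K K0 h]; exists (`|k| * K) => [|x y]; first by rewrite mulr_ge0.
by rewrite -mulrBr normrM -mulrA ler_wpM2l.
Qed.

Lemma lipschitz_l1_cst n k : lipschitz_l1 (fun _ : Rn R n => k).
Proof. by exists 0 => // x y; rewrite subrr normr0 mul0r. Qed.

Lemma lipschitz_l1_comp n (F : R -> R) K (f : Rn R n -> R) : 0 <= K ->
  (forall x y, `|F x - F y| <= K * `|x - y|) ->
  lipschitz_l1 f -> lipschitz_l1 (fun x => F (f x)).
Proof.
move=> K0 hF [L L0 h]; exists (K * L) => [|x y]; first exact: mulr_ge0.
by apply: le_trans (hF _ _) _; rewrite -mulrA ler_wpM2l.
Qed.

(** These properties are proved together: integrating the slices in the first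
    coordinate requires their continuity, which follows from the properties in the
    lower dimension. *)
Let mean_spec n := [/\
  forall f g : Rn R n -> R, lipschitz_l1 f -> lipschitz_l1 g ->
    (forall x, cube R n x -> f x <= g x) -> cube_mean f <= cube_mean g,
  forall f g : Rn R n -> R, lipschitz_l1 f -> lipschitz_l1 g ->
    cube_mean (fun x => f x + g x) = cube_mean f + cube_mean g,
  forall k (f : Rn R n -> R), lipschitz_l1 f ->
    cube_mean (fun x => k * f x) = k * cube_mean f &
  forall k, cube_mean (fun _ : Rn R n => k) = k].

Let spec_slice n (S : mean_spec n) (f : Rn R n.+1 -> R) : lipschitz_l1 f ->
  exists2 K, 0 <= K & forall x x' : R,
  `|cube_mean (fun y => f (Rcons (x, y))) - cube_mean (fun y => f (Rcons (x', y)))|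
    <= K * `|x - x'|.
Proof.
case: S => Sle SD SZ Sc lf; case: (lf) => K K0 h; exists K => // x x'.
have half z z' : cube_mean (fun y => f (Rcons (z, y))) <=
    cube_mean (fun y => f (Rcons (z', y))) + K * `|z - z'|.
  rewrite -[X in _ + X]Sc -SD; [|exact: lipschitz_l1_slice|exact: lipschitz_l1_cst].
  apply: Sle => [||y _]; first exact: lipschitz_l1_slice.
    by apply: lipschitz_l1D; [exact: lipschitz_l1_slice | exact: lipschitz_l1_cst].
  have := h (Rcons (z, y)) (Rcons (z', y)).
  rewrite manhattan_Rcons manhattanxx addr0 => /ler_normlW; lra.
have h1 := half x x'; have h2 := half x' x; rewrite distrC in h2.
by rewrite ler_norml; apply/andP; split; lra.
Qed.

Let specP n : mean_spec n.
Proof.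
elim: n => [|n S].
  split => //= f g _ _; apply.
  by move=> [].
have cs (f : Rn R n.+1 -> R) : lipschitz_l1 f -> continuous (fun x => cube_mean (fun y => f (Rcons (x, y)) : R)).
  by move=> lf; have [K K0 h] := spec_slice S lf; exact: lipschitz_cont h.
case: (S) => Sle SD SZ Sc; split => /=.
- move=> f g lf lg fg; apply: unit_mean_le; [exact: cs|exact: cs|] => x x01.
  apply: Sle; [exact: lipschitz_l1_slice|exact: lipschitz_l1_slice|] => y cy.
  by apply: fg; exact: Rcons_cube.
- move=> f g lf lg; rewrite -unit_meanD; [|exact: cs|exact: cs].
  by congr unit_mean; apply/funext => x; apply: SD; exact: lipschitz_l1_slice.
- move=> k f lf; rewrite -unit_meanZ; last exact: cs.
  by congr unit_mean; apply/funext => x; apply: SZ; exact: lipschitz_l1_slice.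
- move=> k; rewrite -[RHS](unit_mean_cst k).
  by congr unit_mean; apply/funext => x; exact: Sc.
Qed.

Lemma cube_mean_le n (f g : Rn R n -> R) : lipschitz_l1 f -> lipschitz_l1 g ->
  (forall x, cube R n x -> f x <= g x) -> cube_mean f <= cube_mean g.
Proof. by case: (specP n) => h _ _ _; exact: h. Qed.

Lemma cube_meanD n (f g : Rn R n -> R) : lipschitz_l1 f -> lipschitz_l1 g ->
  cube_mean (fun x => f x + g x) = cube_mean f + cube_mean g.
Proof. by case: (specP n) => _ h _ _; exact: h. Qed.

Lemma cube_meanZ n k (f : Rn R n -> R) : lipschitz_l1 f ->
  cube_mean (fun x => k * f x) = k * cube_mean f.
Proof. by case: (specP n) => _ _ h _; exact: h. Qed.

Lemma cube_mean_cst n k : cube_mean (fun _ : Rn R n => k) = k.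
Proof. by case: (specP n) => _ _ _ h; exact: h. Qed.

Lemma cube_mean_slice_continuous n (f : Rn R n.+1 -> R) : lipschitz_l1 f ->
  continuous (fun x => cube_mean (fun y => f (Rcons (x, y)))).
Proof. by move=> /(spec_slice (specP n))[K K0 h]; exact: lipschitz_cont h. Qed.

Definition origin n : Rn R n := [tuple (0 : R) | _ < n].

Lemma manhattan_origin n (x : Rn R n) : cube R n x -> manhattan x (origin n) <= n%:R.
Proof.
move=> cx; rewrite -[n in leRHS]card_ord -sum1_card natr_sum.
apply: ler_sum => i _; rewrite tnth_mktuple subr0.
by have /andP[h1 h2] := cx i; rewrite ger0_norm.
Qed.

End expectation.

(** * Functional isoperimetry in the cube *)

Section iso.
Context {R : realType}.
Variables (G0 g0 dg0 : R -> R) (C : R).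
Hypotheses (P0 : profile G0 g0 dg0) (C0 : 0 <= C).
Hypotheses (g0C : forall x, `|g0 x| <= C) (dg0C : forall x, `|dg0 x| <= C).

(** The mean over the cube of [G0 (s - (x_1 + .. + x_n))], see
    [cube_mean_coord_sum]. *)
Fixpoint uniform_smoothing n (s : R) : R :=
  match n with
  | 0 => G0 s
  | m.+1 => unit_mean (fun x => uniform_smoothing m (s - x))
  end.

Lemma unit_mean_window (G Q : R -> R) s : (forall x : R, is_derive x 1 Q (G x)) ->
  continuous G -> unit_mean (fun x => G (s - x)) = Q s - Q (s - 1).
Proof.
move=> dQ cG.
have dS (x : R) : is_derive x (1 : R) (fun x : R => s - x) (-1 : R).
  by rewrite -[X in is_derive _ _ _ X]add0r; exact: is_deriveB.
have dF (x : R) : is_derive x 1 (fun x => - Q (s - x)) (G (s - x)).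
  have h := @is_derive1_comp R Q (fun s' => s - s') x _ _ (dQ (s - x)) (dS x).
  by apply: (is_derive_eq (is_deriveN h)); rewrite mulrN mulr1 opprK.
rewrite (unit_mean_derive dF); first by rewrite subr0 opprK addrC.
move=> x; apply: continuous_comp; last exact: cG.
exact: is_derive_continuous dS x.
Qed.

Lemma uniform_smoothing_profile n :
  exists g dg, profile (uniform_smoothing n) g dg.
Proof.
elim: n => [|n [g [dg P]]]; first by exists g0, dg0.
have [Q dQ] := continuous_antiderivative (profile_cont P).
have := profile_window P dQ.
rewrite (_ : (fun s => Q s - Q (s - 1)) = uniform_smoothing n.+1); last first.
  by apply/funext => s; rewrite /= (unit_mean_window s dQ (profile_cont P)).
by move=> P'; do 2 eexists; exact: P'.
Qed.

Lemma uniform_smoothing_cont n : continuous (uniform_smoothing n).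
Proof. by have [g [dg P]] := uniform_smoothing_profile n; exact: profile_cont P. Qed.

Lemma uniform_smoothing_cont_sub n s : continuous (fun x => uniform_smoothing n (s - x)).
Proof.
move=> x; apply: (@continuous_comp _ _ _ (fun x : R => s - x) (uniform_smoothing n)).
  by apply: cvgB; [exact: cvg_cst | exact: cvg_id].
exact: uniform_smoothing_cont.
Qed.

Lemma uniform_smoothing_bounds n s :
  G0 (s - n%:R) <= uniform_smoothing n s <= G0 s.
Proof.
elim: n s => [|n IH] s; first by rewrite subr0 lexx.
have cc k : continuous (fun _ : R => k : R) by move=> x; exact: cvg_cst.
have cs := @uniform_smoothing_cont_sub n s.
apply/andP; split => /=.
  rewrite -[leLHS]unit_mean_cst; apply: unit_mean_le => // x /andP[x0 x1].
  have /andP[h _] := IH (s - x).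
  by apply: le_trans h; apply: (profile_ler P0); rewrite -natr1; lra.
rewrite -[leRHS]unit_mean_cst; apply: unit_mean_le => // x /andP[x0 x1].
have /andP[_ h] := IH (s - x).
by apply: le_trans h _; apply: (profile_ler P0); lra.
Qed.

Lemma uniform_smoothing_inverse n m M y : m <= M -> G0 m <= y <= G0 M ->
  exists a, uniform_smoothing n a = y.
Proof.
move=> mM /andP[my yM].
have mM' : m <= M + n%:R by have : 0 <= n%:R :> R by []; lra.
have /andP[_ h1] := uniform_smoothing_bounds n m.
have /andP[h2 _] := uniform_smoothing_bounds n (M + n%:R).
rewrite addrK in h2.
have cn : {within `[m, M + n%:R], continuous (uniform_smoothing n)}.
  by apply: continuous_subspaceT; exact: uniform_smoothing_cont.
have [] := IVT (v := y) mM' cn.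
  by rewrite ge_min le_max (le_trans h1 my)/= (le_trans yM h2) orbT.
by move=> a _ <-; exists a.
Qed.

Lemma G0_lipschitz x y : `|G0 x - G0 y| <= C * `|x - y|.
Proof.
wlog yx : x y / y <= x.
  move=> wl; have [/wl//|/ltW/wl] := leP y x.
  by rewrite distrC [X in _ <= _ * X -> _]distrC.
have [c _ ->] := mean_value (profile_derive P0) yx.
by rewrite normrM ler_wpM2r.
Qed.

Lemma g0_lipschitz x y : `|g0 x - g0 y| <= C * `|x - y|.
Proof.
wlog yx : x y / y <= x.
  move=> wl; have [/wl//|/ltW/wl] := leP y x.
  by rewrite distrC [X in _ <= _ * X -> _]distrC.
have [c _ ->] := mean_value (profile_derive2 P0) yx.
by rewrite normrM ler_wpM2r.
Qed.

Lemma G0_taylor x y : `|G0 y - G0 x - g0 x * (y - x)| <= C * (y - x) ^+ 2.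
Proof.
have key c : `|c - x| <= `|y - x| ->
    `|g0 c * (y - x) - g0 x * (y - x)| <= C * (y - x) ^+ 2.
  move=> h; rewrite -mulrBl normrM -(real_normK (num_real (y - x))) expr2 mulrA.
  apply: ler_wpM2r => //; apply: le_trans (g0_lipschitz _ _) _.
  exact: ler_wpM2l.
have [xy|/ltW yx] := leP x y.
  have [c /andP[c1 c2] ->] := mean_value (profile_derive P0) xy.
  by apply: key; rewrite !ger0_norm ?subr_ge0//; lra.
have [c /andP[c1 c2] e] := mean_value (profile_derive P0) yx.
have -> : G0 y - G0 x = g0 c * (y - x) by lra.
by apply: key; rewrite !ler0_norm ?subr_le0//; lra.
Qed.

Section slices.
Variables (n : nat) (f : Rn R n -> R) (f' : Rn R n -> R) (h : R).
Hypotheses (lf : lipschitz_l1 f) (lf' : lipschitz_l1 f').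

Let lG k : lipschitz_l1 k -> lipschitz_l1 (fun x : Rn R n => G0 (k x)).
Proof. exact: lipschitz_l1_comp C0 G0_lipschitz. Qed.

Let lg k : lipschitz_l1 k -> lipschitz_l1 (fun x : Rn R n => g0 (k x)).
Proof. exact: lipschitz_l1_comp C0 g0_lipschitz. Qed.

(** A second-order expansion under the mean, which bounds the variation of the
    slices of [G0 \o f] by their boundary cost. *)
Lemma cube_mean_variation : (forall x, `|f' x - f x| <= h) ->
  `|cube_mean (fun x => G0 (f' x)) - cube_mean (fun x => G0 (f x))| <=
    cube_mean (fun x => g0 (f x)) * h + C * h ^+ 2.
Proof.
move=> hh.
have h0 : 0 <= h by exact: le_trans (normr_ge0 _) (hh (origin n)).
have pt x : `|G0 (f' x) - G0 (f x)| <= h * g0 (f x) + C * h ^+ 2.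
  have t := G0_taylor (f x) (f' x).
  have gp := profile_gt0 P0 (f x).
  have -> : G0 (f' x) - G0 (f x) =
    g0 (f x) * (f' x - f x) + (G0 (f' x) - G0 (f x) - g0 (f x) * (f' x - f x)) by ring.
  apply: le_trans (ler_normD _ _) _; apply: lerD.
    by rewrite normrM (gtr0_norm gp) mulrC ler_wpM2r// ltW.
  apply: le_trans t _; apply: ler_wpM2l => //.
  by rewrite -(real_normK (num_real (f' x - f x))) ler_sqr ?nnegrE.
have lh : lipschitz_l1 (fun x => h * g0 (f x) + C * h ^+ 2).
  by apply: lipschitz_l1D; [apply/lipschitz_l1Z/lg | exact: lipschitz_l1_cst].
have Eh : cube_mean (fun x => h * g0 (f x) + C * h ^+ 2) =
    cube_mean (fun x => g0 (f x)) * h + C * h ^+ 2.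
  rewrite cube_meanD; [|exact/lipschitz_l1Z/lg|exact: lipschitz_l1_cst].
  by rewrite cube_meanZ ?cube_mean_cst 1?mulrC//; exact: lg.
rewrite -Eh ler_norml lerBDr lerBlDr -!cube_meanD//; try exact: lG.
rewrite addrC lerBlDr -cube_meanD//; try exact: lG.
apply/andP; split; apply: cube_mean_le; try (by apply: lipschitz_l1D => //; exact: lG);
  try exact: lG; move=> x _; have := pt x; rewrite ler_norml => /andP[]; lra.
Qed.

(** The derivative in [c] of the mean of [G0 (f + c)], with a uniform remainder. *)
Lemma cube_mean_shift :
  `|cube_mean (fun x => G0 (f x + h)) - cube_mean (fun x => G0 (f x)) -
    cube_mean (fun x => g0 (f x)) * h| <= C * h ^+ 2.
Proof.
have pt x : `|G0 (f x + h) - G0 (f x) - h * g0 (f x)| <= C * h ^+ 2.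
  by have := G0_taylor (f x) (f x + h); have -> : f x + h - f x = h by [ring]; rewrite [h * _]mulrC.
have lfh : lipschitz_l1 (fun x => f x + h).
  by apply: lipschitz_l1D => //; exact: lipschitz_l1_cst.
have Eh k : cube_mean (fun x => G0 (f x) + (h * g0 (f x) + k)) =
    cube_mean (fun x => G0 (f x)) + cube_mean (fun x => g0 (f x)) * h + k.
  rewrite cube_meanD; [|exact: lG|]; last first.
    by apply: lipschitz_l1D; [apply/lipschitz_l1Z/lg | exact: lipschitz_l1_cst].
  rewrite cube_meanD; [|exact/lipschitz_l1Z/lg|exact: lipschitz_l1_cst].
  by rewrite cube_meanZ ?cube_mean_cst 1?[h * _]mulrC ?addrA//; exact: lg.
have lk k : lipschitz_l1 (fun x => G0 (f x) + (h * g0 (f x) + k)).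
  apply: lipschitz_l1D; first exact: lG.
  by apply: lipschitz_l1D; [apply/lipschitz_l1Z/lg | exact: lipschitz_l1_cst].
have h1 : cube_mean (fun x => G0 (f x + h)) <=
    cube_mean (fun x => G0 (f x) + (h * g0 (f x) + C * h ^+ 2)).
  apply: cube_mean_le => //; first exact: (lG lfh).
  by move=> x _; have := pt x; rewrite ler_norml => /andP[]; lra.
have h2 : cube_mean (fun x => G0 (f x) + (h * g0 (f x) + - (C * h ^+ 2))) <=
    cube_mean (fun x => G0 (f x + h)).
  apply: cube_mean_le => //; first exact: (lG lfh).
  by move=> x _; have := pt x; rewrite ler_norml => /andP[]; lra.
by rewrite !Eh in h1 h2; rewrite ler_norml; apply/andP; split; lra.
Qed.

Hypothesis f1 : forall x y, `|f x - f y| <= manhattan x y.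

Lemma cube_mean_inverse : exists a, uniform_smoothing n a = cube_mean (fun x => G0 (f x)).
Proof.
apply: (@uniform_smoothing_inverse n (f (origin n) - n%:R) (f (origin n) + n%:R)).
  by have : 0 <= n%:R :> R by []; lra.
have bd x : cube R n x -> `|f x - f (origin n)| <= n%:R.
  by move=> cx; apply: le_trans (f1 _ _) (manhattan_origin cx).
apply/andP; split.
  rewrite -[leLHS](@cube_mean_cst R n).
  apply: cube_mean_le; [exact: lipschitz_l1_cst|exact: lG|] => x /bd.
  by rewrite ler_norml => /andP[? ?]; apply: (profile_ler P0); lra.
rewrite -[leRHS](@cube_mean_cst R n).
apply: cube_mean_le; [exact: lG|exact: lipschitz_l1_cst|] => x /bd.
by rewrite ler_norml => /andP[? ?]; apply: (profile_ler P0); lra.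
Qed.

End slices.

Lemma lipschitz_l1_nonexpansive n (f : Rn R n -> R) :
  (forall x y, `|f x - f y| <= manhattan x y) -> lipschitz_l1 f.
Proof. by move=> h; exists 1 => // x y; rewrite mul1r. Qed.

(** Induction on the dimension.  A slice of [f] in the first coordinate has mass
    [u x = uniform_smoothing n (a x)] and boundary cost [W x].  The induction
    hypothesis is [g (a x) <= W x], and the Lipschitz condition in the first
    coordinate bounds the variation of [u] by [W]: these are the hypotheses of
    [one_dim_isoperimetry]. *)
Lemma functional_isoperimetry n g dg (P : profile (uniform_smoothing n) g dg)
    (f : Rn R n -> R) r :
  (forall x y, `|f x - f y| <= manhattan x y) ->
  cube_mean (fun x => G0 (f x)) = uniform_smoothing n r ->
  g r <= cube_mean (fun x => g0 (f x)).
Proof.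
have unique_g n' g1 g2 dg1 dg2 : profile (uniform_smoothing n') g1 dg1 ->
    profile (uniform_smoothing n') g2 dg2 -> g1 =1 g2.
  move=> P1 P2 x.
  have h1 := profile_derive P1 x; have h2 := profile_derive P2 x.
  by rewrite -(@derive_val _ _ _ _ _ _ _ h1) -(@derive_val _ _ _ _ _ _ _ h2).
elim: n g dg P f r => [|n IH] g dg P f r f1 e.
  have := unique_g _ _ _ _ _ P (P0 : profile (uniform_smoothing 0) _ _) => -> /=.
  by rewrite /= in e; rewrite (profile_inj P0 e).
have [gn [dgn Pn]] := uniform_smoothing_profile n.
have [Q dQ] := continuous_antiderivative (profile_cont Pn).
have cU := profile_cont Pn.
have sE : uniform_smoothing n.+1 = fun s => Q s - Q (s - 1).
  by apply/funext => s; rewrite /= (unit_mean_window s dQ cU).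
have Pw := profile_window Pn dQ; rewrite -sE in Pw.
rewrite (unique_g _ _ _ _ _ P Pw).
have fs x y y' : `|f (Rcons (x, y)) - f (Rcons (x, y'))| <= manhattan y y'.
  by apply: le_trans (f1 _ _) _; rewrite manhattan_Rcons subrr normr0 add0r.
have lfs x := lipschitz_l1_nonexpansive (fs x).
have [a aE] := choice (fun x : R => cube_mean_inverse (lfs x) (fs x)).
have lf := lipschitz_l1_nonexpansive f1.
have lGf : lipschitz_l1 (fun x => G0 (f x)) by exact: lipschitz_l1_comp C0 G0_lipschitz lf.
have lgf : lipschitz_l1 (fun x => g0 (f x)) by exact: lipschitz_l1_comp C0 g0_lipschitz lf.
apply: (one_dim_isoperimetry (u := fun x => cube_mean (fun y => G0 (f (Rcons (x, y)))))
  Pn dQ (cube_mean_slice_continuous lGf) (cube_mean_slice_continuous lgf) C0 (a := a)).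
- by move=> x; rewrite aE.
- by move=> x; apply: (IH _ _ Pn); [exact: fs | rewrite aE].
- move=> x y; rewrite -(real_normK (num_real (y - x))).
  apply: cube_mean_variation => // z.
  by apply: le_trans (f1 _ _) _; rewrite manhattan_Rcons manhattanxx addr0.
- by rewrite -[LHS]/(cube_mean (fun x => G0 (f x))) e sE.
Qed.

(** If the mean of [G0 (f + c)] is [uniform_smoothing n (a c)], its derivative in
    [c] is at least the density at [a c] by [functional_isoperimetry], so that [a]
    grows at least at unit speed. *)
Lemma isoperimetry n (f : Rn R n -> R) r t :
  (forall x y, `|f x - f y| <= manhattan x y) -> 0 <= t ->
  cube_mean (fun x => G0 (f x)) = uniform_smoothing n r ->
  uniform_smoothing n (r + t) <= cube_mean (fun x => G0 (f x + t)).
Proof.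
move=> f1 t0 e.
have [g [dg P]] := uniform_smoothing_profile n.
have f1c c x y : `|f x + c - (f y + c)| <= manhattan x y.
  by have -> : f x + c - (f y + c) = f x - f y by [ring]; exact: f1.
have [a aE] := choice (fun c : R => cube_mean_inverse (lipschitz_l1_nonexpansive (f1c c)) (f1c c)).
have a0 : a 0 = r.
  by apply: (profile_inj P); rewrite aE -e; congr cube_mean; apply/funext => x; rewrite addr0.
rewrite -aE (profile_le P) -a0.
apply/ler_addgt0Pr => e1 e10.
(* [k] makes room for the quadratic remainder: it suffices that [a c - (1 - k) * c]
   is nondecreasing *)
pose k := Num.min (e1 / (t + 1)) 1 / 2.
have k0 : 0 < k by rewrite divr_gt0// lt_min ltr01 andbT divr_gt0//; lra.
have k1 : k < 1.
  have : Num.min (e1 / (t + 1)) 1 <= 1 by rewrite ge_min lexx orbT.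
  by rewrite /k; lra.
have kt : k * t <= e1.
  have h : Num.min (e1 / (t + 1)) 1 <= e1 / (t + 1) by rewrite ge_min lexx.
  apply: (@le_trans _ _ (e1 / (t + 1) * t)).
    apply: ler_wpM2r => //; apply: le_trans h; rewrite /k in k0 *; lra.
  by rewrite mulrAC ler_pdivrMr; nra.
suff : a 0 - (1 - k) * 0 <= a t - (1 - k) * t by lra.
apply: (@locally_nondecreasing _ (fun c => a c - (1 - k) * c)) => // x _.
set p := a x.
have gp := profile_gt0 P p.
have kgp : 0 < k * g p by rewrite mulr_gt0.
have [d1 d10 hd1] := continuous_delta p (profile_cont2 P) kgp.
pose d2 := k ^+ 2 * g p / (C + 1).
have C1 : 0 < C + 1 by apply: ltr_wpDl; [exact: C0 | exact: ltr01].
have d20 : 0 < d2 by rewrite /d2 divr_gt0// mulr_gt0// exprn_gt0.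
exists (Num.min d1 d2); first by rewrite lt_min d10.
move=> y _; rewrite lt_min => /andP[yd1 yd2].
have -> : (a y - (1 - k) * y - (p - (1 - k) * x)) = a y - (p + (1 - k) * (y - x)) by ring.
have iso : g p <= cube_mean (fun z => g0 (f z + x)).
  by apply: (functional_isoperimetry P); [exact: f1c | rewrite -aE].
have := @cube_mean_shift n (fun z => f z + x) (y - x) (lipschitz_l1_nonexpansive (f1c x)).
under [X in cube_mean X - _ - _]eq_fun do rewrite -addrA subrKC.
rewrite -!aE -/p; set N := cube_mean _ in iso *.
set h := y - x in yd1 yd2 *.
have Ch : C * `|h| <= k ^+ 2 * g p.
  apply: (@le_trans _ _ ((C + 1) * `|h|)); first by apply: ler_wpM2r => //; lra.
  by rewrite mulrC -ler_pdivlMr; [exact: ltW | lra].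
have gc c : `|c - p| <= `|h| -> (1 - k) * g c <= g p - C * `|h|.
  move=> /le_lt_trans /(_ yd1) /hd1 /ltr_normlW hc.
  apply: (@le_trans _ _ ((1 - k) * (g p + k * g p))); last by move: Ch; rewrite expr2; lra.
  apply: ler_wpM2l; lra.
have [h0|/ltW h0] := leP 0 h.
  rewrite (ger0_norm h0) in Ch gc yd1 yd2 *.
  move=> hN; rewrite mulr_ge0// subr_ge0 -(profile_le P).
  have pp : p <= p + (1 - k) * h by rewrite lerDl mulr_ge0//; lra.
  have [c /andP[c1 c2] ec] := mean_value (profile_derive P) pp.
  have := gc c; rewrite ger0_norm ?subr_ge0// => /(_ _) gc'.
  have hc : c - p <= h by have : k * h >= 0 by [rewrite mulr_ge0// ltW]; lra.
  have h1 := ler_wpM2r h0 (gc' hc).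
  have h2 := ler_wpM2r h0 iso.
  move: hN; rewrite ler_norml => /andP[hN _].
  rewrite (_ : p + (1 - k) * h - p = (1 - k) * h) in ec; last by ring.
  move: h1 ec hN; rewrite expr2 !mulrA; nra.
rewrite (ler0_norm h0) in Ch gc yd1 yd2 *.
move=> hN; rewrite mulr_le0// subr_le0 -(profile_le P).
have pp : p + (1 - k) * h <= p by rewrite gerDl mulr_ge0_le0//; lra.
have [c /andP[c1 c2] ec] := mean_value (profile_derive P) pp.
have := gc c; rewrite ler0_norm ?subr_le0// => /(_ _) gc'.
have hc : - (c - p) <= - h by have : k * h <= 0 by [rewrite mulr_ge0_le0// ltW]; lra.
have h1 := ler_wnM2r h0 (gc' hc).
have h2 := ler_wnM2r h0 iso.
move: hN; rewrite ler_norml => /andP[_ hN].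
rewrite (_ : p - (p + (1 - k) * h) = - ((1 - k) * h)) in ec; last by ring.
have ec' : uniform_smoothing n (p + (1 - k) * h) =
   uniform_smoothing n p + (1 - k) * g c * h by move: ec; lra.
rewrite ec'; move: h1 hN; rewrite expr2; lra.
Qed.

End iso.

(** * The Gaussian distribution function *)

Section gauss.
Context {R : realType}.
Implicit Types (x y a : R).

Definition gauss x : R := expR (- pi * x ^+ 2).

Let sd : R := Num.sqrt (2 * pi)^-1.

Let sd_sqr : sd ^+ 2 = (2 * pi)^-1.
Proof. by rewrite sqr_sqrtr// invr_ge0 mulr_ge0// pi_ge0. Qed.

Let pi_neq0 : (pi : R) != 0. Proof. by rewrite gt_eqF// pi_gt0. Qed.

Let sd_neq0 : sd != 0.
Proof. by rewrite gt_eqF// sqrtr_gt0 invr_gt0 mulr_gt0// pi_gt0. Qed.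

(** [Phi] is the distribution function of the centred normal law of variance
    [1 / (2 * pi)], whose density has peak [1]. *)
Lemma gauss_normal_pdf x : gauss x = normal_pdf 0 sd x.
Proof.
rewrite normal_pdfE// /normal_peak /normal_fun sd_sqr subr0.
have -> : (2 * pi)^-1 * pi *+ 2 = 1 :> R.
  by rewrite -(mulr_natr (_ * pi)); move: (pi : R) pi_neq0 => p p0; field.
rewrite sqrtr1 invr1 mul1r /gauss; congr expR.
by rewrite -(mulr_natr (_ ^-1)); move: (pi : R) pi_neq0 => p p0; field.
Qed.

Let integrable_gauss A : measurable A ->
  lebesgue_measure.-integrable A (EFin \o gauss).
Proof.
move=> mA; have -> : EFin \o gauss = (fun x => (normal_pdf 0 sd x)%:E).
  by apply/funext => x /=; rewrite gauss_normal_pdf.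
by apply: (integrableS _ _ (subsetT _)) => //; exact: integrable_normal_pdf.
Qed.

Let Phi_normal_prob x : (Phi x)%:E = normal_prob 0 sd `]-oo, x].
Proof.
rewrite /Phi /Rintegral /normal_prob fineK; last first.
  by apply: integrable_fin_num => //; exact: integrable_gauss.
by apply: eq_integral => y _; rewrite -gauss_normal_pdf.
Qed.

Lemma gauss_gt0 x : 0 < gauss x. Proof. exact: expR_gt0. Qed.

Lemma is_derive_gauss x : is_derive x 1 gauss (- (2 * pi) * x * gauss x).
Proof.
have h : is_derive x 1 (fun x : R => - pi * x ^+ 2) (- (2 * pi) * x).
  apply: is_derive_eq; rewrite /GRing.scale/=; ring.
apply: (is_derive_eq (is_derive1_comp (is_derive_expR _) h)).
by rewrite mulrC.
Qed.

Lemma is_derive_Phi x : is_derive x 1 (@Phi R) (gauss x).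
Proof.
have [] := @continuous_FTC1 R gauss -oo%O x (x + 1).
- lra.
- exact: integrable_gauss.
- by rewrite ltNyr.
- exact: is_derive_continuous is_derive_gauss x.
by rewrite derive1E => h1 h2; exact: DeriveDef h1 h2.
Qed.

Lemma Phi_ge0 x : 0 <= Phi x.
Proof. by apply: Rintegral_ge0 => y _; exact: expR_ge0. Qed.

Lemma Phi_ltr x y : x < y -> Phi x < Phi y.
Proof.
move=> xy; have [c _ e] := mean_value is_derive_Phi (ltW xy).
by rewrite -subr_gt0 e mulr_gt0 ?gauss_gt0// subr_gt0.
Qed.

Lemma Phi_lt x y : (Phi x < Phi y) = (x < y).
Proof.
apply/idP/idP; last exact: Phi_ltr.
by apply: contraTT; rewrite -!leNgt le_eqVlt => /predU1P[->//|/Phi_ltr/ltW].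
Qed.

Lemma Phi_le x y : (Phi x <= Phi y) = (x <= y).
Proof. by rewrite leNgt Phi_lt -leNgt. Qed.

Lemma Phi_le1 x : Phi x <= 1.
Proof.
rewrite -lee_fin Phi_normal_prob.
exact: (@probability_le1 _ _ _ (normal_prob 0 sd)).
Qed.

Lemma Phi_gt0 x : 0 < Phi x.
Proof. by apply: le_lt_trans (Phi_ge0 (x - 1)) _; rewrite Phi_lt; lra. Qed.

Let idR : measurableTypeR R -> R := idfun.

#[local] HB.instance Definition _ :=
  @isMeasurableFun.Build _ _ _ _ idR (@measurable_id _ _ setT).

Let PhiE : (fun x => (Phi x)%:E) = cdf (idR : {RV normal_prob 0 sd >-> R}).
Proof. by apply/funext => x; rewrite Phi_normal_prob. Qed.

Lemma Phi_cvgy : Phi x @[x --> +oo] --> (1 : R).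
Proof.
have : (fun x => (@Phi R x)%:E) @ +oo --> (1 : R)%:E by rewrite PhiE; exact: cvg_cdfy1.
by move/fine_cvg.
Qed.

Lemma Phi_cvgNy : Phi x @[x --> -oo] --> (0 : R).
Proof.
have : (fun x => (@Phi R x)%:E) @ -oo --> (0 : R)%:E by rewrite PhiE; exact: cvg_cdfNy0.
by move/fine_cvg.
Qed.

Lemma Phi_sym x : Phi (- x) = 1 - Phi x.
Proof.
have dN (y : R) : is_derive y (1 : R) (fun y : R => - y) (-1 : R).
  by have := @is_deriveN _ _ _ _ y (1 : R) _ (is_derive_id y (1 : R)).
have dS (y : R) : is_derive y 1 (fun y => Phi y + Phi (- y)) (0 : R).
  have h := @is_derive1_comp R (@Phi R) (fun s => - s) y _ _ (is_derive_Phi (- y)) (dN y).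
  apply: (is_derive_eq (is_deriveD (is_derive_Phi y) h)).
  by rewrite /gauss sqrrN mulrN mulr1 subrr.
have cst y z : Phi y + Phi (- y) = Phi z + Phi (- z).
  wlog yz : y z / y <= z.
    by move=> wl; have [/wl//|/ltW/wl] := leP y z.
  have [c _] := mean_value dS yz; rewrite mul0r => /eqP.
  by rewrite subr_eq0 => /eqP.
have lim : Phi y + Phi (- y) @[y --> +oo] --> (1 + 0 : R).
  apply: cvgD; first exact: Phi_cvgy.
  by have := Phi_cvgNy; rewrite cvgNy_compNP.
suff : Phi x + Phi (- x) = 1 by lra.
rewrite addr0 in lim.
apply/esym; apply: (cvg_unique _ lim); first exact: Rhausdorff.
rewrite (_ : (fun y => Phi y + Phi (- y)) = fun=> Phi x + Phi (- x)); last first.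
  by apply/funext => y; exact: cst.
exact: cvg_cst.
Qed.

End gauss.

Section tail.
Context {R : realType}.

(** For [a >= 1] the density [gauss a] is at most [2 * pi * a * gauss a], which is the
    rate of decrease of the right-hand side; both sides vanish at infinity. *)
Lemma Phi_tail_upper (a : R) : 1 <= a -> Phi (- a) <= gauss a.
Proof.
move=> a1.
have dN (y : R) : is_derive y (1 : R) (fun y : R => - y) (-1 : R).
  by have := @is_deriveN _ _ _ _ y (1 : R) _ (is_derive_id y (1 : R)).
have dD (y : R) : is_derive y 1 (fun y => Phi (- y) - gauss y)
    ((2 * pi * y - 1) * gauss y).
  have h := @is_derive1_comp R (@Phi R) (fun s => - s) y _ _ (is_derive_Phi (- y)) (dN y).
  apply: (is_derive_eq (is_deriveB h (is_derive_gauss y))).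
  have -> : gauss (- y) = gauss y by rewrite /gauss sqrrN.
  by move: (gauss y) (pi : R) => g p; ring.
apply/ler_addgt0Pr => e e0.
near (ninfty_nbhs R) => x.
have xa : a <= - x by rewrite lerNr; near: x; exact: nbhs_ninfty_le (num_real _).
have xe : Phi x < e by near: x; exact: (cvgr_lt _ Phi_cvgNy).
have : Phi (- a) - gauss a <= Phi (- - x) - gauss (- x).
  apply: (nondecreasing_of_derive dD) => // y /andP[ay _].
  have y1 := le_trans a1 ay.
  rewrite mulr_ge0 ?(ltW (gauss_gt0 y))// subr_ge0.
  by have := @pi_ge2 R; move: (pi : R) => p; nra.
by rewrite opprK; have := gauss_gt0 (- x); lra.
Unshelve. all: by end_near. Qed.

(** The left-hand side is a lower bound for the mass of an interval of length one. *)
Lemma Phi_tail_lower (a : R) : 0 <= a -> gauss (a + 1) <= Phi (- a).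
Proof.
move=> a0; have aa : - (a + 1) <= - a by lra.
have [c /andP[c1 c2] ec] := mean_value (@is_derive_Phi R) aa.
have h : gauss (a + 1) <= gauss c.
  rewrite /gauss ler_expR !mulNr lerN2 ler_wpM2l ?pi_ge0//.
  by rewrite -[leLHS]sqrrN; apply: lerXn2r; rewrite ?nnegrE; lra.
have := Phi_ge0 (- (a + 1)).
by move: ec; rewrite (_ : - a - - (a + 1) = 1); [rewrite mulr1; lra | ring].
Qed.

Lemma Phi_surjective (y : R) : 0 < y < 1 -> exists x, Phi x = y.
Proof.
move=> /andP[y0 y1].
near (ninfty_nbhs R) => a; near (pinfty_nbhs R) => b.
have ab : a <= b.
  apply: (@le_trans _ _ 0); first by near: a; exact: nbhs_ninfty_le (num_real _).
  by near: b; exact: nbhs_pinfty_ge (num_real _).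
have ha : Phi a < y by near: a; exact: (cvgr_lt _ Phi_cvgNy).
have hb : y < Phi b by near: b; exact: (cvgr_gt _ Phi_cvgy).
have cP : {within `[a, b], continuous (@Phi R)}.
  by apply: continuous_subspaceT; exact: is_derive_continuous is_derive_Phi.
have [] := IVT (v := y) ab cP.
  by rewrite ge_min le_max (ltW ha) (ltW hb) orbT.
by move=> x _ <-; exists x.
Unshelve. all: by end_near. Qed.

Lemma Phi_invK (y : R) : 0 < y < 1 -> Phi (Phi_inv y) = y.
Proof.
by move=> /Phi_surjective[x <-]; apply: pinvK; rewrite inE; exists x.
Qed.

Lemma Phi0 : Phi 0 = 2^-1 :> R.
Proof. by have := Phi_sym (0 : R); rewrite oppr0; lra. Qed.

End tail.

(** * Taylor estimates for the Gaussian *)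

(** One step of Taylor's inequality: a power bound on the derivative is integrated
    into a bound of the next order. *)
Lemma power_bound_of_derive {R : realType} (F f : R -> R) K k (a b : R) :
  (forall x : R, Num.min a b <= x <= Num.max a b -> is_derive x 1 F (f x)) -> 0 <= K ->
  (forall x, Num.min a b <= x <= Num.max a b -> `|f x| <= K * `|x - a| ^+ k) ->
  `|F b - F a| <= K * `|b - a| ^+ k.+1.
Proof.
move=> dF K0 hf.
have key c : Num.min a b <= c <= Num.max a b -> `|c - a| <= `|b - a| ->
    `|f c * (b - a)| <= K * `|b - a| ^+ k.+1.
  move=> cI ca; rewrite normrM exprSr mulrA ler_wpM2r//.
  apply: le_trans (hf c cI) _; apply: ler_wpM2l => //.
  by apply: lerXn2r => //; rewrite nnegrE.
have [ab|/ltW ba] := leP a b.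
  rewrite (min_idPl ab) (max_idPr ab) in dF key.
  have [c cab ->] := mean_value_in dF ab; apply: key => //.
  by move: cab => /andP[c1 c2]; rewrite !ger0_norm ?subr_ge0//; lra.
rewrite (min_idPr ba) (max_idPl ba) in dF key.
have [c cab e] := mean_value_in dF ba.
rewrite (_ : F b - F a = f c * (b - a)); last lra.
apply: key => //.
by move: cab => /andP[c1 c2]; rewrite !ler0_norm ?subr_le0//; lra.
Qed.

#[local] Existing Instance is_derive_gauss.
#[local] Existing Instance is_derive_Phi.

Section gauss_bounds.
Context {R : realType}.
Implicit Types (x y a : R).

Definition gauss2 x : R := - (2 * pi) * x * gauss x.
Definition gauss3 x : R := (4 * pi ^+ 2 * x ^+ 2 - 2 * pi) * gauss x.

Lemma is_derive_gauss2 x : is_derive x 1 gauss2 (gauss3 x).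
Proof.
have h1 : is_derive x 1 (fun x : R => - (2 * pi) * x) (- (2 * pi)).
  by apply: is_derive_eq; rewrite /GRing.scale/= mulr1.
apply: (is_derive_eq (is_deriveM h1 (is_derive_gauss x))).
rewrite /GRing.scale/= /gauss3; move: (pi : R) => p; ring.
Qed.

(** As [pi / 2 >= 1], the square root of [1 / gauss x] is at least [1 + x ^+ 2].  This
    bounds the product of [gauss] by any polynomial of degree at most four. *)
Lemma gauss_decay x : (1 + x ^+ 2) ^+ 2 * gauss x <= 1.
Proof.
have h : 1 + x ^+ 2 <= expR (pi / 2 * x ^+ 2).
  apply: le_trans (expR_ge1Dx _); rewrite lerD2l ler_peMl ?sqr_ge0//.
  by have := @pi_ge2 R; move: (pi : R) => p; lra.
have -> : gauss x = (expR (pi / 2 * x ^+ 2) ^+ 2)^-1.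
  rewrite -expRM_natl -expRN /gauss; congr expR.
  by move: (pi : R) => p; field.
rewrite ler_pdivrMr ?exprn_gt0 ?expR_gt0// mul1r.
by apply: lerXn2r => //; rewrite nnegrE ?expR_ge0// addr_ge0// sqr_ge0.
Qed.

Lemma gauss_poly_bound (c q x : R) : 0 <= c -> `|q| <= c * (1 + x ^+ 2) ^+ 2 ->
  `|q * gauss x| <= c.
Proof.
move=> c0 h; rewrite normrM (gtr0_norm (gauss_gt0 x)).
apply: (@le_trans _ _ (c * (1 + x ^+ 2) ^+ 2 * gauss x)).
  by rewrite ler_wpM2r// ltW// gauss_gt0.
by rewrite -mulrA ler_piMr// gauss_decay.
Qed.

Lemma norm_le_poly x : `|x| <= (1 + x ^+ 2) ^+ 2.
Proof.
rewrite -(real_normK (num_real x)); have := normr_ge0 x; move: `|x| => y y0.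
have h : 0 <= (y - 1) ^+ 2 by exact: sqr_ge0.
have : 0 <= y ^+ 2 * y ^+ 2 by rewrite mulr_ge0// sqr_ge0.
have := sqr_ge0 y; rewrite !expr2 in h *; lra.
Qed.

Lemma norm_cube_le_poly x : `|x| ^+ 3 <= (1 + x ^+ 2) ^+ 2.
Proof.
rewrite -(real_normK (num_real x)); have := normr_ge0 x; move: `|x| => y y0.
have h : 0 <= y ^+ 2 * (y - 1) ^+ 2 by rewrite mulr_ge0 ?sqr_ge0.
have : 0 <= y ^+ 2 * y ^+ 2 by rewrite mulr_ge0// sqr_ge0.
have := sqr_ge0 y; rewrite exprS !expr2 in h *; lra.
Qed.

Lemma gauss_le1 x : `|gauss x| <= 1.
Proof.
rewrite -[gauss x]mul1r; apply: gauss_poly_bound => //.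
rewrite normr1 mul1r; have := sqr_ge0 x; rewrite [leRHS]expr2; nra.
Qed.

Lemma gauss2_bound x : `|gauss2 x| <= 2 * pi.
Proof.
have p0 := @pi_ge0 R; apply: gauss_poly_bound; first by rewrite mulr_ge0.
rewrite normrM normrN (ger0_norm (_ : 0 <= 2 * pi)) ?mulr_ge0//.
by rewrite ler_wpM2l ?mulr_ge0//; exact: norm_le_poly.
Qed.

Lemma gauss3_bound x : `|gauss3 x| <= 4 * pi ^+ 2 + 2 * pi.
Proof.
have p0 := @pi_ge0 R; apply: gauss_poly_bound.
  by rewrite addr_ge0// mulr_ge0// sqr_ge0.
move: p0; move: (pi : R) => p p0.
apply: le_trans (ler_normB _ _) _.
have x2 := sqr_ge0 x; have p2 := sqr_ge0 p.
have h : 1 <= (1 + x ^+ 2) ^+ 2 by rewrite [leRHS]expr2; nra.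
have h' : x ^+ 2 <= (1 + x ^+ 2) ^+ 2 by rewrite [leRHS]expr2; nra.
rewrite [leRHS]mulrDl; apply: lerD.
  have p4 : 0 <= 4 * p ^+ 2 by rewrite mulr_ge0.
  by rewrite ger0_norm; [rewrite ler_wpM2l | rewrite mulr_ge0].
have p3 : 0 <= 2 * p by rewrite mulr_ge0.
by rewrite ger0_norm// ler_peMr.
Qed.

(** This expression, divided by [4 * pi * t ^+ 2] and taken at [x = w / sqrt t], is
    the second derivative of [Phi (w / sqrt t)] in [t]. *)
Lemma gauss_variance_bound x : `|- 2^-1 * x * gauss3 x - gauss2 x| <= 2 * pi ^+ 2 + 3 * pi.
Proof.
have p0 := @pi_ge0 R.
have -> : - 2^-1 * x * gauss3 x - gauss2 x =
    (3 * pi * x - 2 * pi ^+ 2 * x ^+ 3) * gauss x.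
  by rewrite /gauss3 /gauss2; move: (pi : R) (gauss x) => p g; field.
apply: gauss_poly_bound; first by rewrite addr_ge0// mulr_ge0// sqr_ge0.
move: p0; move: (pi : R) => p p0.
apply: le_trans (ler_normB _ _) _; rewrite [leLHS]addrC [leRHS]mulrDl; apply: lerD.
  rewrite normrM normrX (ger0_norm (_ : 0 <= 2 * p ^+ 2)) ?mulr_ge0 ?sqr_ge0//.
  by rewrite ler_wpM2l ?norm_cube_le_poly// mulr_ge0 ?sqr_ge0.
rewrite normrM (ger0_norm (_ : 0 <= 3 * p)) ?mulr_ge0//.
by rewrite ler_wpM2l ?norm_le_poly// mulr_ge0.
Qed.

Lemma Phi_taylor2 a h :
  `|Phi (a + h) - Phi a - h * gauss a - h ^+ 2 / 2 * gauss2 a| <=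
    (4 * pi ^+ 2 + 2 * pi) * `|h| ^+ 3.
Proof.
set K := 4 * pi ^+ 2 + 2 * pi.
have K0 : 0 <= K by rewrite addr_ge0 ?mulr_ge0 ?sqr_ge0 ?pi_ge0.
have dsub (y : R) : is_derive y (1 : R) (fun x : R => x - a) (1 : R).
  by rewrite -[X in is_derive _ _ _ X]subr0; exact: is_deriveB.
have s1 y : `|gauss2 y - gauss2 a| <= K * `|y - a|.
  rewrite -[X in _ * X]expr1.
  apply: (@power_bound_of_derive _ gauss2 gauss3 K 0 a y (fun x _ => is_derive_gauss2 x) K0).
  by move=> x _; rewrite expr0 mulr1; exact: gauss3_bound.
have s2 y : `|gauss y - gauss a - (y - a) * gauss2 a| <= K * `|y - a| ^+ 2.
  have := @power_bound_of_derive _ (fun y => gauss y - (y - a) * gauss2 a)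
    (fun y => gauss2 y - gauss2 a) K 1 a y _ K0.
  rewrite subrr mul0r subr0 addrAC; apply => [x _|x _]; last by rewrite expr1.
  apply: is_derive_eq; rewrite /GRing.scale/=.
  by rewrite -/(gauss2 x); ring.
have := @power_bound_of_derive _ (fun y => Phi y - (y - a) * gauss a - (y - a) ^+ 2 / 2 * gauss2 a)
    (fun y => gauss y - gauss a - (y - a) * gauss2 a) K 2 a (a + h) _ K0.
have -> : a + h - a = h by ring.
rewrite subrr mul0r expr0n/= !mul0r !subr0 => main.
rewrite (_ : _ - _ - _ - _ = Phi (a + h) - h * gauss a - h ^+ 2 / 2 * gauss2 a - Phi a); last by ring.
apply: main => [x _|x _]; last exact: s2.
apply: is_derive_eq; rewrite /GRing.scale/=.
by field.
Qed.

End gauss_bounds.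

#[local] Existing Instance is_derive_gauss2.

(** * Central limit theorem for uniform sums *)

Section clt.
Context {R : realType}.
Implicit Types (x y a w : R).

Let K3 : R := 4 * pi ^+ 2 + 2 * pi.
Let K4 : R := (2 * pi ^+ 2 + 3 * pi) / (4 * pi).

Let K30 : 0 <= K3.
Proof. by rewrite addr_ge0 ?mulr_ge0 ?sqr_ge0 ?pi_ge0. Qed.

Let K40 : 0 <= K4.
Proof. by rewrite divr_ge0 ?addr_ge0 ?mulr_ge0 ?sqr_ge0 ?pi_ge0. Qed.

Lemma is_derive_Phi_scaled s x :
  is_derive x 1 (fun x => Phi (x / s)) (s^-1 * gauss (x / s)).
Proof.
have h : is_derive x 1 (fun x : R => x / s) s^-1.
  by apply: is_derive_eq; rewrite /GRing.scale/= mulr1 mulr0 add0r.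
by apply: (is_derive_eq (is_derive1_comp _ h)); rewrite mulrC.
Qed.

Lemma gauss_profile s : 0 < s ->
  profile (fun x => Phi (x / s)) (fun x => s^-1 * gauss (x / s))
    (fun x => s^-1 ^+ 2 * gauss2 (x / s)).
Proof.
move=> s0; split.
- exact: is_derive_Phi_scaled.
- move=> x; have h : is_derive x 1 (fun x : R => x / s) s^-1.
    by apply: is_derive_eq; rewrite /GRing.scale/= mulr1 mulr0 add0r.
  apply: (is_derive_eq (is_deriveZ s^-1 (is_derive1_comp (is_derive_gauss _) h))).
  rewrite /GRing.scale/= -/(gauss2 (x / s)); ring.
- by move=> x; rewrite mulr_gt0 ?invr_gt0// gauss_gt0.
- move=> a b ab; rewrite /gauss2.
  set A := gauss (a / s); set B := gauss (b / s).
  have A0 : 0 < A := gauss_gt0 _; have B0 : 0 < B := gauss_gt0 _.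
  rewrite [leLHS](_ : _ = - (s^-1 ^+ 4 * (2 * pi) * A * B * b)); last first.
    by move: (pi : R) => p; ring.
  rewrite [leRHS](_ : _ = - (s^-1 ^+ 4 * (2 * pi) * A * B * a)); last first.
    by move: (pi : R) => p; ring.
  rewrite lerN2 ler_wpM2l// !mulr_ge0 ?exprn_ge0 ?invr_ge0 ?pi_ge0 ?(ltW s0) ?(ltW A0)//.
  exact: ltW.
Qed.

Lemma gauss_profile_bound s x : 1 <= s ->
  `|s^-1 * gauss (x / s)| <= 1 + 2 * pi /\
  `|s^-1 ^+ 2 * gauss2 (x / s)| <= 1 + 2 * pi.
Proof.
move=> s1; have s0 : 0 < s by exact: lt_le_trans s1.
have i0 : 0 <= s^-1 by rewrite invr_ge0 ltW.
have i1 : s^-1 <= 1 by rewrite invf_le1.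
have p0 := @pi_ge0 R.
split; rewrite normrM ger0_norm ?exprn_ge0//.
  apply: (@le_trans _ _ 1); last by rewrite lerDl mulr_ge0.
  by rewrite -[leRHS]mulr1 ler_pM// gauss_le1.
apply: (@le_trans _ _ (2 * pi)); last by rewrite lerDr.
rewrite -[leRHS]mul1r ler_pM// ?exprn_ge0// ?exprn_ile1//.
exact: gauss2_bound.
Qed.

(** The first-order term vanishes when the expansion is centred at the midpoint, and
    the second-order one is half the variance [1 / 12] of the uniform law. *)
Lemma Phi_average_expansion w s : 0 < s ->
  `|unit_mean (fun x => Phi ((w - x) / s)) - Phi ((w - 2^-1) / s) -
    gauss2 ((w - 2^-1) / s) / (24 * s ^+ 2)| <= K3 / s ^+ 3.
Proof.
move=> s0; set a := (w - 2^-1) / s.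
pose q x := Phi a + (2^-1 - x) / s * gauss a + ((2^-1 - x) / s) ^+ 2 / 2 * gauss2 a.
pose Q x := x * Phi a - (2^-1 - x) ^+ 2 / (2 * s) * gauss a
  - (2^-1 - x) ^+ 3 / (6 * s ^+ 2) * gauss2 a.
have dQ (x : R) : is_derive x 1 Q (q x).
  apply: is_derive_eq; rewrite /GRing.scale/= /q.
  move: (Phi a) (gauss a) (gauss2 a) => A B D.
  by field; rewrite gt_eqF.
have cq : continuous q.
  have dq (x : R) : is_derive x 1 q (- s^-1 * gauss a - ((2^-1 - x) / s) / s * gauss2 a).
    apply: is_derive_eq; rewrite /GRing.scale/=.
    move: (Phi a) (gauss a) (gauss2 a) => A B D.
    by field; rewrite gt_eqF.
  exact: is_derive_continuous dq.
have cP : continuous (fun x => Phi ((w - x) / s)).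
  have dP (x : R) : is_derive x 1 (fun x => Phi ((w - x) / s)) (- s^-1 * gauss ((w - x) / s)).
    have h : is_derive x 1 (fun x : R => (w - x) / s) (- s^-1).
      by apply: is_derive_eq; rewrite /GRing.scale/=; field; rewrite gt_eqF.
    apply: (is_derive_eq (is_derive1_comp _ h)).
    by rewrite mulrC.
  exact: is_derive_continuous dP.
have -> : unit_mean (fun x => Phi ((w - x) / s)) - Phi a - gauss2 a / (24 * s ^+ 2) =
  unit_mean (fun x => Phi ((w - x) / s)) - unit_mean q.
  rewrite (unit_mean_derive dQ cq) /Q; move: (Phi a) (gauss a) (gauss2 a) => A B D.
  by field; rewrite gt_eqF.
apply: unit_mean_dist => // x /andP[x0 x1].
have := Phi_taylor2 a ((2^-1 - x) / s); rewrite -/K3.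
have -> : a + (2^-1 - x) / s = (w - x) / s by rewrite /a; field; rewrite gt_eqF.
rewrite /q; set A := Phi _; set B := Phi _ => h.
rewrite (_ : A - _ = A - B - (2^-1 - x) / s * gauss a - ((2^-1 - x) / s) ^+ 2 / 2 * gauss2 a); last by ring.
apply: le_trans h _; rewrite ler_wpM2l// -exprVn; apply: lerXn2r; rewrite ?nnegrE ?invr_ge0 ?(ltW s0)//.
rewrite normrM normfV (gtr0_norm s0) ler_piMl ?invr_ge0 ?(ltW s0)//.
by rewrite ler_norml; apply/andP; split; lra.
Qed.

(** The first-order term comes from the heat equation: the derivative of
    [Phi (w / sqrt t)] in [t] is [1 / (4 * pi)] times its second derivative in [w]. *)
Lemma Phi_variance_expansion w t e : 0 < t -> 0 <= e ->
  `|Phi (w / Num.sqrt (t + e)) - Phi (w / Num.sqrt t) -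
    e * gauss2 (w / Num.sqrt t) / (4 * pi * t)| <= K4 * e ^+ 2 / t ^+ 2.
Proof.
move=> t0 e0.
have p0 : (pi : R) != 0 by rewrite gt_eqF// pi_gt0.
pose X s : R := w / Num.sqrt s.
pose D s : R := gauss2 (X s) / (4 * pi * s).
have dX (s : R) : 0 < s -> is_derive s 1 X (- X s / (2 * s)).
  move=> s0.
  have q0 : 0 < Num.sqrt s by rewrite sqrtr_gt0.
  have h := is_derive1_sqrt s0.
  have h2 := is_deriveV (lt0r_neq0 q0) h.
  apply: (is_derive_eq (is_deriveZ w h2)).
  rewrite [RHS](_ : _ = - (w / Num.sqrt s) / (2 * Num.sqrt s ^+ 2)); last first.
    by rewrite sqr_sqrtr ?(ltW s0).
  rewrite /GRing.scale/=.
  move: (Num.sqrt s) q0 => q q0.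
  by field; rewrite gt_eqF.
have dV (s : R) : 0 < s -> is_derive s 1 (fun s => Phi (X s)) (D s).
  move=> s0; apply: (is_derive_eq (is_derive1_comp _ (dX s s0))).
  rewrite /D /gauss2; move: (X s) (gauss _) p0 => x g; move: (pi : R) => p p0.
  by field; rewrite p0 gt_eqF.
pose D' s := (- 2^-1 * X s * gauss3 (X s) - gauss2 (X s)) / (4 * pi * s ^+ 2).
have dD (s : R) : 0 < s -> is_derive s 1 D (D' s).
  move=> s0.
  have h1 : is_derive s 1 (fun s => gauss2 (X s)) (gauss3 (X s) * (- X s / (2 * s))).
    exact: (is_derive1_comp _ (dX s s0)).
  have h2 := is_deriveV (lt0r_neq0 s0) (is_derive_id s (1 : R)).
  have h3 := is_deriveZ ((4 * pi)^-1) (is_deriveM h1 h2).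
  have -> : D = (4 * pi)^-1 \*: ((fun s => gauss2 (X s)) * (fun s => s^-1)).
    by apply/funext => z; rewrite /D invfM mulrCA.
  apply: (is_derive_eq h3); rewrite /D'.
  rewrite /GRing.scale/=; move: (X s) (gauss3 _) (gauss2 _) p0 => x g g'.
  move: (pi : R) => p p0.
  by field; rewrite p0 gt_eqF.
have K0 : 0 <= K4 / t ^+ 2 by rewrite divr_ge0// sqr_ge0.
have rng u s : t <= u -> Num.min t u <= s <= Num.max t u -> t <= s.
  by move=> tu; rewrite (min_idPl tu) => /andP[].
have s1 u : t <= u -> `|D u - D t| <= K4 / t ^+ 2 * `|u - t|.
  move=> tu; rewrite -[X in _ * X]expr1.
  apply: (@power_bound_of_derive _ D D' _ 0 t u _ K0) => s /(rng _ _ tu) ts.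
    by apply: dD; exact: lt_le_trans t0 ts.
  have s0 : 0 < s by exact: lt_le_trans t0 ts.
  rewrite /D'.
  rewrite expr0 mulr1 normrM normfV (ger0_norm (_ : 0 <= 4 * pi * s ^+ 2)); last first.
    by rewrite mulr_ge0 ?sqr_ge0// mulr_ge0 ?pi_ge0.
  rewrite [leRHS](_ : _ = (2 * pi ^+ 2 + 3 * pi) / (4 * pi * t ^+ 2)); last first.
    by rewrite /K4 -[LHS]mulrA -invfM.
  have P4 : 0 < 4 * pi :> R by rewrite mulr_gt0 ?pi_gt0.
  have h1 : 0 < 4 * pi * t ^+ 2 by rewrite mulr_gt0 ?exprn_gt0.
  have h2 : 0 < 4 * pi * s ^+ 2 by rewrite mulr_gt0 ?exprn_gt0.
  apply: ler_pM; [by []|by rewrite invr_ge0 ltW|exact: gauss_variance_bound|].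
  rewrite lef_pV2 ?posrE// ler_pM2l//.
  by apply: lerXn2r; rewrite ?nnegrE ?(ltW t0) ?(ltW s0).
have te : t <= t + e by rewrite lerDl.
have := @power_bound_of_derive _ (fun s => Phi (X s) - (s - t) * D t) (fun s => D s - D t)
   (K4 / t ^+ 2) 1 t (t + e) _ K0.
rewrite subrr mul0r subr0 (_ : t + e - t = e); last by ring.
rewrite (ger0_norm e0) => main.
rewrite (_ : _ - _ - _ = Phi (X (t + e)) - e * D t - Phi (X t)); last first.
  by rewrite /D [e * (_ / _)]mulrA addrAC.
rewrite (_ : K4 * e ^+ 2 / t ^+ 2 = K4 / t ^+ 2 * e ^+ 2); last by rewrite mulrAC.
apply: main => s /(rng _ _ te) ts.
  have hV := dV s (lt_le_trans t0 ts).
  have h1 : is_derive s 1 (fun s : R => (s - t) * D t) (D t).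
    by apply: is_derive_eq; rewrite /GRing.scale/=; ring.
  exact: is_deriveB.
by rewrite expr1; exact: s1.
Qed.

Let K : R := K3 + K4 * (pi / 6) ^+ 2.

(** The increment [pi / 6] of the variance parameter is the one for which the
    second-order terms of the two expansions agree. *)
Lemma Phi_uniform_average w t : 1 <= t ->
  `|unit_mean (fun x => Phi ((w - x) / Num.sqrt t)) -
    Phi ((w - 2^-1) / Num.sqrt (t + pi / 6))| <= K / Num.sqrt t ^+ 3.
Proof.
move=> t1; have t0 : 0 < t by exact: lt_le_trans t1.
have q0 : 0 < Num.sqrt t by rewrite sqrtr_gt0.
have q1 : 1 <= Num.sqrt t by rewrite -[leLHS]sqrtr1; exact: ler_wsqrtr.
have e0 : 0 <= pi / 6 :> R by rewrite divr_ge0 ?pi_ge0.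
have h1 := Phi_average_expansion w q0.
have h2 := Phi_variance_expansion (w - 2^-1) t0 e0.
rewrite sqr_sqrtr ?(ltW t0)// in h1.
have E : pi / 6 * gauss2 ((w - 2^-1) / Num.sqrt t) / (4 * pi * t) =
   gauss2 ((w - 2^-1) / Num.sqrt t) / (24 * t).
  move: (gauss2 _) (@pi_gt0 R) => g; move: (pi : R) => p p0.
  by field; rewrite !gt_eqF.
rewrite E in h2.
have h3 : K4 * (pi / 6) ^+ 2 / t ^+ 2 <= K4 * (pi / 6) ^+ 2 / Num.sqrt t ^+ 3.
  apply: ler_wpM2l; first by rewrite mulr_ge0 ?sqr_ge0.
  rewrite lef_pV2 ?posrE ?exprn_gt0//.
  rewrite -[X in _ <= X ^+ 2]sqr_sqrtr ?(ltW t0)// -exprM.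
  by apply: ler_weXn2l.
rewrite /K [leRHS]mulrDl; move: h1 h2.
set A := unit_mean _; set B := Phi (_ / Num.sqrt t); set D := Phi (_ / Num.sqrt (t + _)); set E2 := gauss2 _ / _.
move=> h1 h2; rewrite (_ : A - D = (A - B - E2) - (D - B - E2)); last first.
  by move: A B D E2 {E h1 h2} => A B D E2; ring.
by apply: le_trans (ler_normB _ _) _; apply: lerD => //; exact: le_trans h3.
Qed.

(** Lindeberg's replacement: each uniform coordinate is exchanged for a Gaussian
    increment, at the cost given by [Phi_uniform_average]. *)
Lemma uniform_smoothing_clt : exists2 K', 0 <= K' & forall tau n s, 1 <= tau ->
  `|uniform_smoothing (fun x => Phi (x / Num.sqrt tau)) n s -
    Phi ((s - n%:R / 2) / Num.sqrt (tau + n%:R * (pi / 6)))| <=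
    n%:R * (K' / Num.sqrt tau ^+ 3).
Proof.
exists K => [|tau n s tau1]; first by rewrite addr_ge0// mulr_ge0 ?sqr_ge0.
 have tau0 : 0 < tau by exact: lt_le_trans tau1.
have p0 : 0 < pi / 6 :> R by rewrite divr_gt0 ?pi_gt0.
have K0 : 0 <= K by rewrite addr_ge0// mulr_ge0 ?sqr_ge0.
set G0 := fun x => _.
have q0 : 0 < Num.sqrt tau by rewrite sqrtr_gt0.
have P := gauss_profile q0; rewrite -/G0 in P.
elim: n s => [|n IH] s.
  by rewrite !mul0r subr0 addr0 subrr normr0.
set t := tau + n%:R * (pi / 6).
have t1 : 1 <= t by rewrite -[leLHS]addr0 lerD// mulr_ge0// ltW.
have st := Phi_uniform_average (s - n%:R / 2) t1.
have -> : tau + n.+1%:R * (pi / 6) = t + pi / 6.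
  by rewrite /t -natr1; move: (pi : R) => p; ring.
have -> : s - n.+1%:R / 2 = s - n%:R / 2 - 2^-1 by rewrite -natr1; field.
have tt : K / Num.sqrt t ^+ 3 <= K / Num.sqrt tau ^+ 3.
  apply: ler_wpM2l => //.
  have le : tau <= t by rewrite lerDl mulr_ge0// ltW.
  have t0 : 0 < t by exact: lt_le_trans t1.
  rewrite lef_pV2 ?posrE ?exprn_gt0 ?sqrtr_gt0//.
  by apply: lerXn2r; rewrite ?nnegrE ?sqrtr_ge0//; exact: ler_wsqrtr.
have h1 : `|uniform_smoothing G0 n.+1 s -
    unit_mean (fun x => Phi ((s - n%:R / 2 - x) / Num.sqrt t))| <= n%:R * (K / Num.sqrt tau ^+ 3).
  apply: unit_mean_dist.
  - exact: uniform_smoothing_cont_sub P n s.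
  - have qt0 : 0 < Num.sqrt t by rewrite sqrtr_gt0 (lt_le_trans _ t1).
    move=> x; apply: (@continuous_comp _ _ _ (fun x : R => s - n%:R / 2 - x)
      (fun x => Phi (x / Num.sqrt t))).
      by apply: cvgB; [exact: cvg_cst | exact: cvg_id].
    exact: profile_cont (gauss_profile qt0) _.
  move=> x _; have := IH (s - x).
  by rewrite (_ : s - x - n%:R / 2 = s - n%:R / 2 - x); last by ring.
rewrite -(natr1 n) [leRHS]mulrDl mul1r.
apply: le_trans (ler_distD (unit_mean (fun x => Phi ((s - n%:R / 2 - x) / Num.sqrt t))) _ _) _.
by apply: lerD => //; exact: le_trans tt.
Qed.

End clt.

(** * Borel structure of the cube *)

Section measure.
Context {R : realType}.
Local Notation mu := (@lebesgue_measure R).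

Lemma measurable_manhattan n (q : Rn R n) :
  measurable_fun [set: Rn R n] (fun x => manhattan x q).
Proof.
apply: measurable_sum => i.
apply: measurableT_comp => //.
apply: measurable_funB => //; exact: measurable_tnth.
Qed.

Lemma rational_dense n (x : Rn R n) e : 0 < e ->
  exists q : n.-tuple rat, manhattan x [tuple (ratr (tnth q i) : R) | i < n] < e.
Proof.
move=> e0; pose d := e / (n%:R + 1).
have n0 : 0 <= n%:R :> R by [].
have d0 : 0 < d by rewrite divr_gt0//; lra.
have h (i : 'I_n) : exists q : rat, `|tnth x i - ratr q| < d :> R.
  have xx : (tnth x i : R) - d < (tnth x i : R) + d by lra.
  have [q] := rat_in_itvoo xx; rewrite in_itv/= => /andP[h1 h2].
  by exists q; rewrite ltr_norml; apply/andP; split; lra.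
have [q hq] := choice h.
exists [tuple q i | i < n].
apply: (@le_lt_trans _ _ (n%:R * d)); last first.
  by rewrite /d mulrA ltr_pdivrMr; nra.
rewrite -[n in leRHS]card_ord -sum1_card natr_sum mulr_suml.
apply: ler_sum => i _; rewrite !tnth_mktuple mul1r; exact: ltW.
Qed.

(** A strict sublevel set is a union of balls centred at rational points, namely those
    on which the Lipschitz bound keeps the function below the level. *)
Lemma lipschitz_l1_measurable n (f : Rn R n -> R) : lipschitz_l1 f ->
  measurable_fun setT f.
Proof.
move=> [K0 K00 hK0]; pose K := K0 + 1; have K1 : 0 < K by rewrite /K; lra.
have hK x y : `|f x - f y| <= K * manhattan x y.
  apply: le_trans (hK0 x y) _; apply: ler_wpM2r; first exact: manhattan_ge0.
  by rewrite lerDl.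
move=> mT; apply: (measurability _ (RGenInftyO.measurableE R)) => //.
move=> /= _ [_ [c ->] <-]; rewrite setTI.
pose pt (q : n.-tuple rat) : Rn R n := [tuple (ratr (tnth q i) : R) | i < n].
have -> : f @^-1` `]-oo, c[ =
    \bigcup_(q in [set: n.-tuple rat])
      [set x | manhattan x (pt q) < (c - f (pt q)) / K].
  apply/seteqP; split => x /=.
    rewrite in_itv/= => fc.
    have e0 : 0 < (c - f x) / (2 * K) by rewrite divr_gt0 ?mulr_gt0 ?subr_gt0.
    have [q hq] := rational_dense x e0; exists q => //=; rewrite -/(pt q) in hq *.
    have := hK x (pt q); rewrite ler_norml => /andP[h _].
    rewrite ltr_pdivlMr// mulrC.
    rewrite ltr_pdivlMr ?mulr_gt0// in hq; lra.
  move=> [q _] /=; rewrite ltr_pdivlMr// in_itv/= => h.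
  by have := hK x (pt q); rewrite ler_norml => /andP[_]; lra.
apply: countable_bigcupT_measurable => [|q]; first exact: countableP.
have := @measurable_manhattan n (pt q) measurableT `]-oo, (c - f (pt q)) / K[%classic.
rewrite setTI => /(_ (measurable_itv _)).
by congr measurable; apply/seteqP; split => x /=; rewrite in_itv.
Qed.

Definition box n k : set (Rn R n) := [set x | forall i, - k <= tnth x i <= k].

Lemma coords_measurable n (P : R -> Prop) : measurable [set x : measurableTypeR R | P x] ->
  measurable [set x : Rn R n | forall i, P (tnth x i)].
Proof.
move=> mP.
have -> : [set x : Rn R n | forall i, P (tnth x i)] =
    \bigcap_(i in [set: 'I_n]) ((fun x : Rn R n => tnth x i) @^-1` [set x | P x]).
  by apply/seteqP; split => x /= h i; [move=> _|]; exact: h.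
apply: fin_bigcap_measurable => // i _.
by rewrite -[_ @^-1` _]setTI; exact: measurable_tnth.
Qed.

Lemma cube_measurable n : measurable (cube R n).
Proof.
apply: (@coords_measurable n (fun x => 0 <= x <= 1)).
by rewrite (_ : [set x | _] = `[0, 1]%classic)//; apply/seteqP; split => x /=; rewrite in_itv.
Qed.

Lemma box_measurable n k : measurable (@box n k).
Proof.
apply: (@coords_measurable n (fun x => - k <= x <= k)).
by rewrite (_ : [set x | _] = `[- k, k]%classic)//; apply/seteqP; split => x /=; rewrite in_itv.
Qed.

Lemma borel_lebesgue_rect n (S : set (Rn R n.+1)) A B : measurable A -> measurable B ->
  @Rcons R n @^-1` S = A `*` B ->
  borel_lebesgue R n.+1 S = (mu A * borel_lebesgue R n B)%E.
Proof.
move=> mA mB e.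
rewrite -[LHS]/(product_measure2 mu (borel_lebesgue R n) (@Rcons R n @^-1` S)) e.
exact: product_measure2E.
Qed.

Lemma Rcons_coords n (P : R -> Prop) :
  @Rcons R n @^-1` [set x | forall i, P (tnth x i)] =
  [set x | P x] `*` [set x | forall i, P (tnth x i)].
Proof.
apply/seteqP; split => -[x y] /= h.
  split; first by have := h ord0; rewrite tnth0.
  by move=> i; have := h (lift ord0 i); rewrite tnthS.
move=> i; have [j ->|->] := unliftP ord0 i.
  by rewrite tnthS; exact: h.2.
by rewrite tnth0; exact: h.1.
Qed.

Lemma borel_lebesgue_box n k : (borel_lebesgue R n (@box n k) < +oo)%E.
Proof.
elim: n => [|n IH]; first by rewrite /= diracE; case: (_ \in _); rewrite ltry.
rewrite (@borel_lebesgue_rect _ _ _ _ _ _ (@Rcons_coords n (fun x => - k <= x <= k))).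
- apply: lte_mul_pinfty => //.
    rewrite (_ : [set x | _] = `[- k, k]%classic); last first.
      by apply/seteqP; split => x /=; rewrite in_itv.
    by rewrite lebesgue_measure_itv/=; case: ifP.
- by rewrite (_ : [set x | _] = `[- k, k]%classic)//; apply/seteqP; split => x /=; rewrite in_itv.
- exact: box_measurable.
Qed.

Lemma borel_lebesgue_cube n : borel_lebesgue R n (cube R n) = 1%E.
Proof.
elim: n => [|n IH]; first by rewrite /= diracE mem_set// => -[].
rewrite (@borel_lebesgue_rect _ _ _ _ _ _ (@Rcons_coords n (fun x => 0 <= x <= 1))).
- rewrite -/(cube R n) IH mule1 (_ : [set x | _] = `[0, 1]%classic); last first.
    by apply/seteqP; split => x /=; rewrite in_itv.
  by rewrite lebesgue_measure_itv/= lte_fin ltr01 oppr0 adde0.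
- by rewrite (_ : [set x | _] = `[0, 1]%classic)//; apply/seteqP; split => x /=; rewrite in_itv.
- exact: cube_measurable.
Qed.

Lemma borel_lebesgue_sigma_finite n : sigma_finite setT (borel_lebesgue R n).
Proof.
exists (fun k => @box n k%:R); last by move=> k; split; [exact: box_measurable | exact: borel_lebesgue_box].
apply/seteqP; split => // x _.
exists (Num.truncn (manhattan x (origin n))).+1 => //= i.
rewrite -ler_norml; apply: ltW; apply: le_lt_trans (truncnS_gt _).
rewrite /manhattan (bigD1 i)//= tnth_mktuple subr0 lerDl.
by apply: sumr_ge0 => j _.
Qed.

End measure.

(** * Volumes and iterated means *)

Section sigma_finite_copy.
Context d (T : measurableType d) (R : realType) (m : {measure set T -> \bar R}).
Hypothesis sf : sigma_finite setT m.

(** A constant for [m], to which the structure given by [sf] can be attached. *)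
Definition sigma_finite_copy : set T -> \bar R := let _ := sf in m.

Let copy0 : sigma_finite_copy set0 = 0%E. Proof. exact: measure0. Qed.
Let copy_ge0 A : (0 <= sigma_finite_copy A)%E. Proof. exact: measure_ge0. Qed.
Let copy_sigma_additive : semi_sigma_additive sigma_finite_copy.
Proof. exact: (@measure_semi_sigma_additive _ _ _ m). Qed.

HB.instance Definition _ := isMeasure.Build _ _ _ sigma_finite_copy
  copy0 copy_ge0 copy_sigma_additive.

HB.instance Definition _ := Measure_isSigmaFinite.Build _ _ _ sigma_finite_copy sf.

End sigma_finite_copy.

Section tonelli.
Context {R : realType}.
Local Notation mu := (@lebesgue_measure R).

Lemma unit_mean_EFin (f : R -> R) : continuous f ->
  (\int[mu]_(x in `[0%R, 1%R]) (f x)%:E = (unit_mean f)%:E)%E.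
Proof.
move=> cf; rewrite /unit_mean /Rintegral fineK//.
by apply: integrable_fin_num => //; exact: continuous_integrable.
Qed.

Lemma product_measure2_tonelli d (T : measurableType d) (m : {measure set T -> \bar R})
    (f : measurableTypeR R * T -> \bar R) :
  sigma_finite setT m -> measurable_fun setT f -> (forall x, 0 <= f x)%E ->
  (\int[product_measure2 mu m]_x f x = \int[mu]_x \int[m]_y f (x, y))%E.
Proof.
move=> sf mf f0.
pose m2 : {sigma_finite_measure set T -> \bar R} := sigma_finite_copy sf.
have E A : measurable A -> (mu \x m2)%E A = product_measure2 mu m A.
  by apply: product_measure_unique => B C mB mC; exact: product_measure2E.
rewrite (@eq_measure_integral _ _ _ _ (mu \x m2)%E); last by move=> A mA _; apply/esym/E.
exact: (@fubini_tonelli1 _ _ _ _ _ mu m2).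
Qed.

Lemma tonelli_step n (f : Rn R n.+1 -> \bar R) :
  measurable_fun setT f -> (forall x, 0 <= f x)%E ->
  (\int[borel_lebesgue R n.+1]_x f x =
   \int[mu]_x \int[borel_lebesgue R n]_y f (Rcons (x, y)))%E.
Proof.
move=> mf f0.
rewrite -[LHS]/(\int[pushforward (product_measure2 mu (borel_lebesgue R n)) (@Rcons R n)]_x f x)%E.
rewrite ge0_integral_pushforward//; last exact: measurable_Rcons.
rewrite preimage_setT.
apply: (@product_measure2_tonelli _ _ _ (f \o @Rcons R n)) => //.
  exact: borel_lebesgue_sigma_finite.
  by apply: measurableT_comp => //; exact: measurable_Rcons.
by move=> x; exact: f0.
Qed.

Lemma integral_cube n (f : Rn R n -> R) : lipschitz_l1 f -> (forall x, 0 <= f x) ->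
  (\int[borel_lebesgue R n]_(x in cube R n) (f x)%:E = (cube_mean f)%:E)%E.
Proof.
elim: n f => [|n IH] f lf f0.
  rewrite integral_dirac//=.
    by rewrite diracE mem_set ?mul1e// => -[].
  - exact: cube_measurable.
  - by apply/measurable_EFinP; apply: measurable_funTS; exact: lipschitz_l1_measurable.
have mf : measurable_fun setT f by exact: lipschitz_l1_measurable.
rewrite integral_mkcond tonelli_step; last 2 first.
- apply/(measurable_restrictT _ (@cube_measurable R n.+1)).
  by apply: measurable_funTS; apply/measurable_EFinP.
- by move=> x; rewrite erestrict_ge0// => ? _; rewrite lee_fin.
rewrite -[RHS]unit_mean_EFin; last exact: cube_mean_slice_continuous.
rewrite [RHS]integral_mkcond; apply: eq_integral => x _.
rewrite patchE; case: ifPn => [|xI].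
  rewrite inE/= in_itv/= => x01.
  rewrite -IH; [|exact: lipschitz_l1_slice|by []].
  rewrite [RHS]integral_mkcond; apply: eq_integral => y _.
  rewrite !patchE; congr (if _ then _ else _).
  apply/idP/idP; rewrite !inE; last exact: Rcons_cube.
  by move=> h i; have := h (lift ord0 i); rewrite tnthS.
rewrite integral0_eq// => y _; rewrite patchE; case: ifPn => //.
rewrite inE => /(_ ord0); rewrite tnth0 => x01.
by move/negP : xI; rewrite inE/= in_itv/=.
Qed.

(** Markov's inequality, applied to a Borel superset of [A] as [A] is arbitrary. *)
Lemma vol_le n (A : set (Rn R n)) (f : Rn R n -> R) : lipschitz_l1 f ->
  (forall x, 0 <= f x) -> A `<=` cube R n -> (forall x, A x -> 1 <= f x) ->
  (vol A <= (cube_mean f)%:E)%E.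
Proof.
move=> lf f0 Ac Af.
have mf : measurable_fun setT f by exact: lipschitz_l1_measurable.
pose S := cube R n `&` (f @^-1` `[1, +oo[).
have mS : measurable S.
  apply: measurableI; first exact: cube_measurable.
  by rewrite -[_ @^-1` _]setTI; apply: mf => //.
have AS : A `<=` S.
  by move=> x Ax; split; [exact: Ac | rewrite /= in_itv/= andbT; exact: Af].
apply: (le_trans (le_mu_ext _ AS)).
rewrite measurable_mu_extE// -(integral_cube lf f0).
have -> : borel_lebesgue R n S = (\int[borel_lebesgue R n]_(x in cube R n) (\1_S x)%:E)%E.
  rewrite integral_indic//; last exact: cube_measurable.
  by congr (borel_lebesgue R n _); rewrite setIidl// => x [].
apply: ge0_le_integral => //.
- exact: cube_measurable.
- by apply/measurable_EFinP; exact: measurable_indic.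
- by apply/measurable_EFinP; apply: measurable_funTS; exact: mf.
move=> x cx; rewrite lee_fin indicE; case: (boolP (x \in S)) => //=.
by rewrite inE => -[_] /=; rewrite in_itv/= andbT.
Qed.

End tonelli.

(** * Separated bodies and corner half-spaces *)

Section bodies.
Context {R : realType}.

Lemma manhattanC n (x y : Rn R n) : manhattan x y = manhattan y x.
Proof. by apply: eq_bigr => i _; rewrite distrC. Qed.

Lemma manhattan_triangle n (x y z : Rn R n) :
  manhattan x z <= manhattan x y + manhattan y z.
Proof. by rewrite -big_split/=; apply: ler_sum => i _; exact: ler_distD. Qed.

Definition dist_to n (A : set (Rn R n)) (x : Rn R n) : R := inf [set manhattan a x | a in A].

Lemma dist_to_lb n (A : set (Rn R n)) x : has_lbound [set manhattan a x | a in A].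
Proof. by exists 0 => _ [a _ <-]; exact: manhattan_ge0. Qed.

Lemma dist_to_lipschitz n (A : set (Rn R n)) x y : A !=set0 ->
  `|dist_to A x - dist_to A y| <= manhattan x y.
Proof.
move=> [a0 Aa0].
have half x' y' : dist_to A x' <= dist_to A y' + manhattan x' y'.
  rewrite -lerBlDr; apply: lb_le_inf; first by exists (manhattan a0 y'), a0.
  move=> _ [a Aa <-]; rewrite lerBlDr.
  apply: (@le_trans _ _ (manhattan a x')).
    by apply: ge_inf; [exact: dist_to_lb | exists a].
  by rewrite [X in _ + X]manhattanC; exact: manhattan_triangle.
have h1 := half x y; have h2 := half y x; rewrite manhattanC in h2.
by rewrite ler_norml; apply/andP; split; lra.
Qed.

Lemma dist_to_in n (A : set (Rn R n)) x : A x -> dist_to A x <= 0.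
Proof.
by move=> Ax; apply: ge_inf; [exact: dist_to_lb | exists x; rewrite ?manhattanxx].
Qed.

Lemma set_dist_le n (A B : set (Rn R n)) a b : A a -> B b -> set_dist A B <= manhattan a b.
Proof.
move=> Aa Bb; apply: ge_inf; last by exists a => //; exists b.
by exists 0 => _ [x _ [y _ <-]]; exact: manhattan_ge0.
Qed.

Lemma dist_to_ge n (A B : set (Rn R n)) b : A !=set0 -> B b -> set_dist A B <= dist_to A b.
Proof.
move=> [a0 Aa0] Bb; apply: lb_le_inf; first by exists (manhattan a0 b), a0.
by move=> _ [a Aa <-]; exact: set_dist_le.
Qed.

Lemma vol_nonempty n (A : set (Rn R n)) (e : R) : 0 < e -> vol A = e%:E -> A !=set0.
Proof.
move=> e0 vA; apply/set0P/eqP => A0; move: vA.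
by rewrite A0 /vol measurable_mu_extE// measure0 => -[] e00; rewrite -e00 ltxx in e0.
Qed.

Definition coord_sum n (x : Rn R n) : R := \sum_(i < n) (tnth x i : R).

Lemma coord_sum_lipschitz n (x y : Rn R n) : `|coord_sum x - coord_sum y| <= manhattan x y.
Proof. by rewrite /coord_sum -sumrB; exact: ler_norm_sum. Qed.

Lemma coord_sum_sub_lipschitz n c : lipschitz_l1 (fun x : Rn R n => c - coord_sum x).
Proof.
apply: lipschitz_l1_nonexpansive => x y.
have -> : c - coord_sum x - (c - coord_sum y) = coord_sum y - coord_sum x by ring.
by rewrite distrC coord_sum_lipschitz.
Qed.

Lemma coord_sum_Rcons n (x : R) (y : Rn R n) : coord_sum (Rcons (x, y)) = x + coord_sum y.
Proof.
rewrite /coord_sum big_ord_recl tnth0; congr (_ + _).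
by apply: eq_bigr => i _; rewrite tnthS.
Qed.

Lemma cube_mean_coord_sum (F : R -> R) n c :
  cube_mean (fun x : Rn R n => F (c - coord_sum x)) = uniform_smoothing F n c.
Proof.
elim: n c => [|n IH] c; first by rewrite /= /coord_sum big_ord0 subr0.
rewrite /=; congr unit_mean; apply/funext => x; rewrite -IH.
by congr cube_mean; apply/funext => y; rewrite coord_sum_Rcons opprD addrA.
Qed.

Lemma vol_cube n : vol (cube R n) = 1%E.
Proof. by rewrite /vol measurable_mu_extE ?borel_lebesgue_cube//; exact: cube_measurable. Qed.

Definition lower_half n b : set (Rn R n) := cube R n `&` [set x | coord_sum x <= b].
Definition upper_half n b : set (Rn R n) := cube R n `&` [set x | b <= coord_sum x].

Lemma vol_complement n (S : set (Rn R n)) k : (vol (cube R n `\` S) <= k%:E)%E ->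
  ((1 - k)%:E <= vol (cube R n `&` S))%E.
Proof.
move=> h.
have : (vol (cube R n) <= vol (cube R n `&` S) + vol (cube R n `\` S))%E.
  rewrite -[X in (vol X <= _)%E](setUIDK (cube R n) S).
  exact: (outer_measureU2 [the {outer_measure set _ -> \bar R} of (borel_lebesgue R n)^*%mu]).
rewrite vol_cube => h2.
rewrite EFinB leeBlDr//; apply: le_trans h2 _.
exact: leeD2l.
Qed.

Section comparison.
Variables (n : nat) (s : R).
Hypothesis s1 : 1 <= s.
Let s0 : 0 < s. Proof. exact: lt_le_trans s1. Qed.
Let G0 x := Phi (x / s).
Let C : R := 1 + 2 * pi.
Let C0 : 0 <= C. Proof. by rewrite addr_ge0 ?mulr_ge0 ?pi_ge0. Qed.
Let G0N x : G0 (- x) = 1 - G0 x. Proof. by rewrite /G0 mulNr Phi_sym. Qed.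
Let P := gauss_profile s0.
Let b1 x := (gauss_profile_bound x s1).1.
Let b2 x := (gauss_profile_bound x s1).2.
Let lipG (f : Rn R n -> R) : lipschitz_l1 f -> lipschitz_l1 (fun x => G0 (f x)).
Proof. by apply: (lipschitz_l1_comp C0); exact: (G0_lipschitz P b1). Qed.

(** [isoperimetry] for the function [h - dist_to A].  It is at least [h] on [A], and
    once shifted by [set_dist A B - 2 * h] it is at most [- h] on [B]; the two
    volumes then bound the means of its smoothed indicator. *)
Lemma separated_bodies (A B : set (Rn R n)) e h :
  body A -> body B -> 0 < e -> vol A = e%:E -> vol B = e%:E ->
  0 <= h -> 2 * h <= set_dist A B ->
  exists r, e * G0 h <= uniform_smoothing G0 n r /\
    uniform_smoothing G0 n (r + (set_dist A B - 2 * h)) <= 1 - e * G0 h.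
Proof.
move=> [_ cA] [_ cB] e0 vA vB h0 ht; set t := set_dist A B in ht *.
have A0 := vol_nonempty e0 vA.
pose f x := dist_to A x.
have f1 c x y : `|(c - f x) - (c - f y)| <= manhattan x y.
  have -> : c - f x - (c - f y) = f y - f x by ring.
  by rewrite distrC; exact: dist_to_lipschitz.
have lf c : lipschitz_l1 (fun x => c - f x) by apply: lipschitz_l1_nonexpansive; exact: f1.
have [r rE] := cube_mean_inverse P C0 b1 (lf h) (f1 h).
exists r.
have G0h : 0 < G0 h by exact: Phi_gt0.
split.
  have : (vol A <= (cube_mean (fun x => (G0 h)^-1 * G0 (h - f x)))%:E)%E.
    apply: vol_le => //.
    - by apply: lipschitz_l1Z; exact: lipG.
    - by move=> x; rewrite mulr_ge0 ?invr_ge0// Phi_ge0.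
    move=> x Ax; rewrite ler_pdivlMl// mulr1 Phi_le ler_pM2r ?invr_gt0//.
    by have := dist_to_in Ax; rewrite /f; lra.
  rewrite vA lee_fin cube_meanZ; last exact: lipG.
  by rewrite ler_pdivlMl// rE mulrC.
have t0 : 0 <= t - 2 * h by lra.
have := isoperimetry P C0 b1 b2 (f1 h) t0 (esym rE).
move/le_trans; apply.
have : (vol B <= (cube_mean (fun x => (G0 h)^-1 * (1 + - 1 * G0 (h - f x + (t - 2 * h)))))%:E)%E.
  have lG : lipschitz_l1 (fun x => G0 (h - f x + (t - 2 * h))).
    by apply: lipG; apply: lipschitz_l1D; [exact: lf | exact: lipschitz_l1_cst].
  apply: vol_le => //.
  - apply: lipschitz_l1Z; apply: lipschitz_l1D; first exact: lipschitz_l1_cst.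
    exact: lipschitz_l1Z.
  - move=> x; rewrite mulr_ge0 ?invr_ge0 ?Phi_ge0//.
    by rewrite mulN1r subr_ge0 Phi_le1.
  move=> x Bx; rewrite ler_pdivlMl// mulr1 mulN1r.
  have : G0 (h - f x + (t - 2 * h)) <= G0 (- h).
    rewrite Phi_le ler_pM2r ?invr_gt0//.
    by have := dist_to_ge A0 Bx; rewrite -/t /f; lra.
  by rewrite G0N; lra.
have lG : lipschitz_l1 (fun x => G0 (h - f x + (t - 2 * h))).
  by apply: lipG; apply: lipschitz_l1D; [exact: lf | exact: lipschitz_l1_cst].
have lG' : lipschitz_l1 (fun x => - 1 * G0 (h - f x + (t - 2 * h))).
  exact: lipschitz_l1Z.
rewrite vB lee_fin cube_meanZ; last by apply: lipschitz_l1D; [exact: lipschitz_l1_cst|].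
rewrite cube_meanD//; last exact: lipschitz_l1_cst.
rewrite cube_mean_cst cube_meanZ// ler_pdivlMl// mulrC; lra.
Qed.

(** Outside the half-space the smoothed indicator is at most [G0 (- h) = 1 - G0 h]. *)
Lemma lower_half_vol b h :
  ((uniform_smoothing G0 n (b - h) - (1 - G0 h))%:E <= vol (@lower_half n b))%E.
Proof.
have lG := lipG (@coord_sum_sub_lipschitz n (b - h)).
have lG' : lipschitz_l1 (fun x : Rn R n => - 1 * G0 (b - h - coord_sum x)).
  exact: lipschitz_l1Z.
have := @vol_complement n [set x | coord_sum x <= b]
   (1 - (uniform_smoothing G0 n (b - h) - (1 - G0 h))).
rewrite (_ : 1 - (1 - _) = uniform_smoothing G0 n (b - h) - (1 - G0 h)); last by ring.
apply.
rewrite (_ : 1 - _ = cube_mean (fun x : Rn R n => (2 - G0 h) + - 1 * G0 (b - h - coord_sum x))); last first.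
  rewrite cube_meanD//; last exact: lipschitz_l1_cst.
  rewrite cube_mean_cst cube_meanZ// (cube_mean_coord_sum G0); ring.
have G1 y : G0 y <= 1 by exact: Phi_le1.
apply: vol_le.
- by apply: lipschitz_l1D => //; exact: lipschitz_l1_cst.
- by move=> x; have := G1 h; have := G1 (b - h - coord_sum x); lra.
- by move=> x [].
move=> x [_ /negP]; rewrite -ltNge => bx.
have : G0 (b - h - coord_sum x) <= G0 (- h).
  by rewrite Phi_le ler_pM2r ?invr_gt0//; lra.
by rewrite G0N; lra.
Qed.

Lemma upper_half_vol b h :
  ((1 - uniform_smoothing G0 n (b + h) - (1 - G0 h))%:E <= vol (@upper_half n b))%E.
Proof.
have lG := lipG (@coord_sum_sub_lipschitz n (b + h)).
have := @vol_complement n [set x | b <= coord_sum x]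
   (uniform_smoothing G0 n (b + h) + (1 - G0 h)).
rewrite (_ : 1 - (_ + _) = 1 - uniform_smoothing G0 n (b + h) - (1 - G0 h)); last by ring.
apply.
rewrite (_ : _ + _ = cube_mean (fun x : Rn R n => (1 - G0 h) + G0 (b + h - coord_sum x))); last first.
  rewrite cube_meanD//; last exact: lipschitz_l1_cst.
  by rewrite cube_mean_cst (cube_mean_coord_sum G0) addrC.
have G1 y : G0 y <= 1 by exact: Phi_le1.
apply: vol_le.
- by apply: lipschitz_l1D => //; exact: lipschitz_l1_cst.
- by move=> x; have := G1 h; have : 0 <= G0 (b + h - coord_sum x) by [exact: Phi_ge0]; lra.
- by move=> x [].
move=> x [_ /negP]; rewrite -ltNge => bx.
have : G0 h <= G0 (b + h - coord_sum x).
  by rewrite Phi_le ler_pM2r ?invr_gt0//; lra.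
lra.
Qed.

End comparison.
End bodies.

(** * Bodies of prescribed volume *)

Section cut.
Context {R : realType}.
Local Notation mu := (@lebesgue_measure R).

Lemma borel_body n (S : set (Rn R n)) : measurable S -> S `<=` cube R n -> body S.
Proof. by move=> mS cS; split => //; exact: caratheodory_measurable_mu_ext. Qed.

Lemma cube_slab n (a b : R) :
  (borel_lebesgue R n.+1 (cube R n.+1 `&` [set x | (a < tnth x ord0 <= b)%R]) <=
    mu `]a, b]%classic)%E.
Proof.
rewrite (@borel_lebesgue_rect _ _ _ (`[0, 1] `&` `]a, b]) (cube R n)).
- rewrite borel_lebesgue_cube mule1.
  by apply: le_measure; rewrite ?inE//; exact: measurableI.
- exact: measurableI.
- exact: cube_measurable.
apply/seteqP; split => -[x y] /=.
  move=> [c]; rewrite tnth0 => xab; split.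
    by rewrite !in_itv/=; split => //; have := c ord0; rewrite tnth0.
  by move=> i; have := c (lift ord0 i); rewrite tnthS.
by rewrite !in_itv/= tnth0 => -[[x01 xab] c]; split => //; exact: Rcons_cube.
Qed.

(** Cut by the first coordinate: the volume of the part below a level is a
    1-Lipschitz function of the level, and takes all intermediate values. *)
Lemma exists_subset_vol n (S : set (Rn R n.+1)) (e : R) : measurable S ->
  S `<=` cube R n.+1 -> 0 < e -> (e%:E <= vol S)%E ->
  exists A, [/\ measurable A, A `<=` S & vol A = e%:E].
Proof.
move=> mS cS e0 eS.
pose nu := borel_lebesgue R n.+1.
pose X (t : R) : set (Rn R n.+1) := S `&` [set x | tnth x ord0 <= t].
have mlt (I : interval R) : measurable [set x : Rn R n.+1 | (tnth x ord0 : R) \in I].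
  have h := @measurable_tnth _ (measurableTypeR R) n.+1 ord0 measurableT [set` I].
  by rewrite setTI in h; apply: h; exact: measurable_itv.
have mX t : measurable (X t).
  by apply: measurableI => //; have := mlt `]-oo, t]; under eq_set do rewrite in_itv/=.
have fin (Y : set (Rn R n.+1)) : measurable Y -> Y `<=` cube R n.+1 -> nu Y \is a fin_num.
  move=> mY cY; rewrite ge0_fin_numE//; apply: (@le_lt_trans _ _ (nu (cube R n.+1))).
    by apply: le_measure; rewrite ?inE//; exact: cube_measurable.
  by rewrite /nu borel_lebesgue_cube ltry.
have cX t : X t `<=` cube R n.+1 by move=> x [/cS].
pose v t := fine (nu (X t)).
have vE t : (v t)%:E = nu (X t) by rewrite /v fineK//; exact: fin.
have mono a b : a <= b -> v a <= v b <= v a + (b - a).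
  move=> ab; rewrite -!lee_fin EFinD !vE; apply/andP; split.
    apply: le_measure; rewrite ?inE//.
    by move=> x [Sx xa]; split => //; exact: le_trans ab.
  pose L : set (Rn R n.+1) := cube R n.+1 `&` [set x | a < tnth x ord0 <= b].
  have mL : measurable L.
    apply: measurableI; first exact: cube_measurable.
    by have := mlt `]a, b]; under eq_set do rewrite in_itv/=.
  apply: (@le_trans _ _ (nu (X a `|` L))).
    apply: le_measure; rewrite ?inE//; first exact: measurableU.
    move=> x [Sx xb]; have [xa|xa] := leP (tnth x ord0) a; first by left.
    by right; split; [exact: cS | rewrite /= xa].
  apply: le_trans (measureU2 _ (mX a) mL) _; apply: leeD2l.
  apply: le_trans (cube_slab _ _ _) _.
  by rewrite lebesgue_measure_itv/= lte_fin; case: ltP => // _; rewrite lee_fin subr_ge0.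
have lip x y : `|v x - v y| <= 1 * `|x - y|.
  rewrite mul1r; wlog xy : x y / x <= y.
    move=> wl; have [/wl//|/ltW/wl] := leP x y.
    by rewrite distrC [X in _ <= X -> _]distrC.
  have /andP[h1 h2] := mono _ _ xy.
  by rewrite !ler0_norm ?subr_le0//; lra.
have v0 : v (-1) = 0.
  rewrite /v (_ : X (-1) = set0) ?measure0//.
  rewrite -subset0 => x [/cS /(_ ord0)/andP[x0 _]] /= x1.
  by have := le_trans x0 x1; rewrite leNgt ltrN10.
have v1 : e <= v 1.
  rewrite -lee_fin vE (_ : X 1 = S); first by move: eS; rewrite /vol measurable_mu_extE.
  apply/seteqP; split => [x []//|x Sx]; split => //=.
  by have /andP[] := cS _ Sx ord0.
have cv : {within `[-1, 1], continuous v}.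
  by apply: continuous_subspaceT; exact: lipschitz_cont lip.
have N11 : -1 <= 1 :> R by lra.
have [] := IVT (v := e) N11 cv.
  by rewrite v0 ge_min le_max (ltW e0)/= v1 orbT.
move=> t _ vt; exists (X t); split => //; first by move=> x [].
by rewrite /vol measurable_mu_extE// -vt vE.
Qed.

Lemma coord_sum_measurable n : measurable_fun setT (@coord_sum R n).
Proof. by apply: measurable_sum => i; exact: measurable_tnth. Qed.

Lemma lower_half_measurable n b : measurable (@lower_half R n b).
Proof.
apply: measurableI; first exact: cube_measurable.
have := @coord_sum_measurable n measurableT `]-oo, b]%classic (measurable_itv _).
by rewrite setTI /preimage; under eq_set do rewrite /= in_itv/=.
Qed.

Lemma upper_half_measurable n b : measurable (@upper_half R n b).
Proof.
apply: measurableI; first exact: cube_measurable.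
have := @coord_sum_measurable n measurableT `[b, +oo[%classic (measurable_itv _).
by rewrite setTI /preimage; under eq_set do rewrite /= in_itv/= andbT.
Qed.

Lemma cube_manhattan n (x y : Rn R n) : cube R n x -> cube R n y -> manhattan x y <= n%:R.
Proof.
move=> cx cy; rewrite -[n in leRHS]card_ord -sum1_card natr_sum.
apply: ler_sum => i _; have /andP[a1 a2] := cx i; have /andP[b1 b2] := cy i.
by rewrite ler_norml; apply/andP; split; lra.
Qed.

Definition body_dists n (e : R) : set R := [set r | exists A B : set (Rn R n),
    [/\ body A, body B, vol A = e%:E, vol B = e%:E & r = set_dist A B]].

Lemma body_dists_ub n e : 0 < e -> ubound (body_dists n e) n%:R.
Proof.
move=> e0 _ [A [B [[_ cA] [_ cB] vA vB ->]]].
have [a Aa] := vol_nonempty e0 vA; have [b Bb] := vol_nonempty e0 vB.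
by apply: le_trans (set_dist_le Aa Bb) _; apply: cube_manhattan; [exact: cA|exact: cB].
Qed.

Lemma max_dist_ge n e b c : (0 < n)%N -> 0 < e ->
  (e%:E <= vol (@lower_half R n b))%E -> (e%:E <= vol (@upper_half R n c))%E ->
  body_dists n e !=set0 /\ c - b <= max_dist n e.
Proof.
case: n => // n _ e0 hb hc.
have lc : lower_half b `<=` cube R n.+1 by move=> x [].
have uc : upper_half c `<=` cube R n.+1 by move=> x [].
have [A [mA AS vA]] := exists_subset_vol (@lower_half_measurable n.+1 b) lc e0 hb.
have [B [mB BS vB]] := exists_subset_vol (@upper_half_measurable n.+1 c) uc e0 hc.
have D : body_dists n.+1 e (set_dist A B).
  exists A, B; split => //; apply: borel_body => //.
    exact: subset_trans AS lc.
  exact: subset_trans BS uc.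
split; first by exists (set_dist A B).
apply: (@le_trans _ _ (set_dist A B)); last first.
  by apply: ub_le_sup => //; exists n.+1%:R; exact: body_dists_ub.
have [a0 Aa0] := vol_nonempty e0 vA; have [b0 Bb0] := vol_nonempty e0 vB.
apply: lb_le_inf; first by exists (manhattan a0 b0), a0 => //; exists b0.
move=> _ [x Ax [y By <-]].
have [_ xb] := AS _ Ax; have [_ yc] := BS _ By; rewrite /= in xb yc.
have := @coord_sum_lipschitz R n.+1 x y; rewrite ler_norml => /andP[h _].
lra.
Qed.

End cut.

(** * The limit of the maximal distance *)

Section asymptotics.
Context {R : realType}.

(** At smoothing width [d * sqrt n] both the accumulated variance and the smoothing
    are of order [n], which leaves an error of order [1 / sqrt n]. *)
Lemma scaled_clt : exists2 K : R, 0 <= K & forall (d : R) n s, 0 < d ->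
  1 <= d * Num.sqrt n%:R ->
  `|uniform_smoothing (fun x => Phi (x / (d * Num.sqrt n%:R))) n s -
    Phi ((s - n%:R / 2) / (Num.sqrt n%:R * Num.sqrt (d ^+ 2 + pi / 6)))| <=
    K / (d ^+ 3 * Num.sqrt n%:R).
Proof.
have [K K0 hK] := @uniform_smoothing_clt R.
exists K => // d n s d0 ds.
have n0 : 0 <= n%:R :> R by [].
have sn0 : 0 < Num.sqrt n%:R :> R.
  by rewrite -(pmulr_rgt0 _ d0); exact: lt_le_trans ds.
have t1 : 1 <= (d * Num.sqrt n%:R) ^+ 2 by rewrite expr_ge1// ltW// mulr_gt0.
have := hK _ n s t1.
have ds0 := le_trans ler01 ds.
rewrite sqrtr_sqr (ger0_norm ds0).
have -> : (d * Num.sqrt n%:R) ^+ 2 + n%:R * (pi / 6) = n%:R * (d ^+ 2 + pi / 6).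
  by rewrite exprMn sqr_sqrtr// mulrDr [_ * n%:R]mulrC.
rewrite sqrtrM//.
suff <- : n%:R * (K / (d * Num.sqrt n%:R) ^+ 3) = K / (d ^+ 3 * Num.sqrt n%:R) by [].
rewrite -{1}(sqr_sqrtr n0).
by move: (Num.sqrt _) sn0 => x x0; field; rewrite !gt_eqF.
Qed.

Variable K : R.
Hypothesis hK : forall (d : R) n s, 0 < d ->
  1 <= d * Num.sqrt n%:R ->
  `|uniform_smoothing (fun x => Phi (x / (d * Num.sqrt n%:R))) n s -
    Phi ((s - n%:R / 2) / (Num.sqrt n%:R * Num.sqrt (d ^+ 2 + pi / 6)))| <=
    K / (d ^+ 3 * Num.sqrt n%:R).

Section fixed_scale.
Variables (n : nat) (d eta e b : R).
Hypotheses (d0 : 0 < d) (ds : 1 <= d * Num.sqrt n%:R) (e0 : 0 < e).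
Let w : R := Num.sqrt (d ^+ 2 + pi / 6).
Let N : R := Num.sqrt n%:R.
Let err := K / (d ^+ 3 * N).

Let N0 : 0 < N.
Proof. by rewrite -(pmulr_rgt0 _ d0); exact: lt_le_trans ds. Qed.

Let w0 : 0 < w.
Proof. by rewrite sqrtr_gt0 addr_gt0// ?exprn_gt0// divr_gt0// pi_gt0. Qed.

Let scale x : x * N / (d * N) = x / d.
Proof. by rewrite -mulf_div divff ?mulr1// gt_eqF. Qed.

Let scale2 x : x * N / (N * w) = x / w.
Proof. by rewrite [N * w]mulrC -mulf_div divff ?mulr1// gt_eqF. Qed.

(** In [separated_bodies] with [h = eta * sqrt n], the first inequality puts the level
    of the first body above the quantile [q1]; the second puts this level, shifted by
    the distance less [2 * h], below the quantile [- q1]. *)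
Lemma body_dists_upper q1 r : 0 < eta -> q1 < 0 -> Phi q1 + err < e * Phi (eta / d) ->
  body_dists n e r -> r <= N * (2 * eta - 2 * w * q1).
Proof.
move=> eta0 q10 hq [A [B [bA bB vA vB ->]]]; set t := set_dist A B.
have [small|big] := leP t (2 * (eta * N)).
  have : 0 <= N * (w * (- q1)) by rewrite !mulr_ge0 ?oppr_ge0 ?ltW.
  lra.
have h0 : 0 <= eta * N by rewrite mulr_ge0 ?ltW.
have [r' [h1 h2]] := separated_bodies ds bA bB e0 vA vB h0 (ltW big).
rewrite -/t -/N scale in h1 h2.
have := hK r' d0 ds; have := hK (r' + (t - 2 * (eta * N))) d0 ds.
rewrite -/N -/w -/err ler_norml => /andP[c1 _]; rewrite ler_norml => /andP[_ c2].
have a1 : Phi q1 < Phi ((r' - n%:R / 2) / (N * w)) by lra.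
have a2 : Phi ((r' + (t - 2 * (eta * N)) - n%:R / 2) / (N * w)) < Phi (- q1).
  by rewrite Phi_sym; lra.
have Nw : 0 < N * w by rewrite mulr_gt0.
rewrite Phi_lt ltr_pdivlMr// in a1; rewrite Phi_lt ltr_pdivrMr// in a2.
move: a1 a2; move: (n%:R / 2 : R) => m a1 a2.
apply: ltW; rewrite mulrBr.
have -> : N * (2 * eta) = 2 * (eta * N) by ring.
have -> : N * (2 * w * q1) = 2 * (q1 * (N * w)) by ring.
rewrite mulNr in a2; lra.
Qed.

(** The corner half-spaces whose levels are [b * sqrt n] away from [n / 2] have volume
    at least [e]. *)
Lemma max_dist_lower :
  e + err <= Phi (- (b + eta) / w) - (1 - Phi (eta / d)) ->
  body_dists n e !=set0 /\ 2 * b * N <= max_dist n e.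
Proof.
move=> h.
set m : R := n%:R / 2.
have -> : 2 * b * N = (m + b * N) - (m - b * N) by ring.
have n0 : (0 < n)%N by rewrite -(ltr0n R) -sqrtr_gt0.
apply: max_dist_ge => //.
  apply: le_trans (lower_half_vol n ds (m - b * N) (eta * N)).
  rewrite lee_fin -/N scale.
  have := hK (m - b * N - eta * N) d0 ds.
  rewrite -/N -/w -/err -/m (_ : m - b * N - eta * N - m = - (b + eta) * N); last by ring.
  by rewrite scale2 ler_norml => /andP[]; lra.
apply: le_trans (upper_half_vol n ds (m + b * N) (eta * N)).
rewrite lee_fin -/N scale.
have := hK (m + b * N + eta * N) d0 ds.
rewrite -/N -/w -/err -/m (_ : m + b * N + eta * N - m = (b + eta) * N); last by ring.
rewrite scale2 ler_norml => /andP[].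
by move: h; rewrite mulNr Phi_sym; lra.
Qed.

End fixed_scale.
End asymptotics.

Section limits.
Context {R : realType}.

(** [d] is chosen first, to make the smoothing harmless, and [n] afterwards. *)
Lemma max_dist_cvg (eps : R) : 0 < eps < 2^-1 ->
  (max_dist n eps / Num.sqrt n%:R) @[n --> \oo]
      --> - 2 * Num.sqrt (pi / 6) * Phi_inv eps.
Proof.
move=> /andP[eps0 eps12].
set q := Phi_inv eps.
have qE : Phi q = eps by apply: Phi_invK; apply/andP; split => //; lra.
have q0 : q < 0 by rewrite -Phi_lt qE Phi0.
have [K K0 hK] := @scaled_clt R.
set s := Num.sqrt (pi / 6).
have s0 : 0 < s by rewrite sqrtr_gt0 divr_gt0// pi_gt0.
set L := - 2 * s * q.
apply/cvgrPdist_le => rho rho0.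
(* for [d = 0] the upper bound [l1] holds with [rho / 2] to spare, and the quantile in
   [l3] exceeds [q]; these strict inequalities persist for small [d] *)
pose eta := rho / 8; pose q1 := q - rho / (8 * s); pose b := (L - rho) / 2.
have eta0 : 0 < eta by rewrite divr_gt0.
have q1q : q1 < q by rewrite gtrBl divr_gt0// mulr_gt0.
have q10 : q1 < 0 by exact: lt_trans q0.
pose W (d : R) := Num.sqrt (d ^+ 2 + pi / 6).
have cW : W d @[d --> 0^'+] --> s.
  apply: cvg_at_right_filter.
  have -> : s = W 0 by rewrite /W expr0n/= add0r.
  apply: (@continuous_comp _ _ _ (fun d : R => d ^+ 2 + pi / 6) Num.sqrt);
    last exact: sqrt_continuous.
  by apply: cvgD; [exact: exprn_continuous | exact: cvg_cst].
have cPhi : Phi (eta / d) @[d --> 0^'+] --> (1 : R).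
  apply/cvgrPdist_lt => e e0.
  near (pinfty_nbhs R) => M.
  have M0 : 0 < M by near: M; exact: nbhs_pinfty_gt (num_real _).
  have hM : 1 - e < Phi M by near: M; apply: (cvgr_gt _ Phi_cvgy); rewrite gtrBl.
  near=> d.
  have d0 : 0 < d by near: d; exact: nbhs_right_gt.
  have : Phi M <= Phi (eta / d).
    rewrite Phi_le ler_pdivlMr// mulrC -ler_pdivlMr//.
    by near: d; apply: nbhs_right_le; rewrite divr_gt0.
  by rewrite ger0_norm ?subr_ge0 ?Phi_le1//; lra.
have cc1 : 2 * eta - 2 * W d * q1 @[d --> 0^'+] --> 2 * eta - 2 * s * q1.
  apply: cvgB; first exact: cvg_cst.
  by apply: cvgM; [apply: cvgM => //; exact: cvg_cst | exact: cvg_cst].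
have cc2 : eps * Phi (eta / d) @[d --> 0^'+] --> eps * 1.
  by apply: cvgM => //; exact: cvg_cst.
have cc3 : Phi (- (b + eta) / W d) - (1 - Phi (eta / d)) @[d --> 0^'+]
    --> Phi (- (b + eta) / s) - (1 - 1).
  apply: cvgB; last by apply: cvgB => //; exact: cvg_cst.
  apply: (@cvg_comp _ _ _ (fun d => - (b + eta) / W d) (@Phi R)); last first.
    exact: (is_derive_continuous is_derive_Phi).
  by apply: cvgM; [exact: cvg_cst | apply: cvgV => //; rewrite gt_eqF].
have l1 : 2 * eta - 2 * s * q1 < L + rho.
  have -> : 2 * eta - 2 * s * q1 = L + rho / 2.
    by rewrite /eta /q1 /L; field; rewrite gt_eqF.
  lra.
have l2 : Phi q1 < eps * 1 by rewrite mulr1 -qE Phi_lt.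
have l3 : eps < Phi (- (b + eta) / s) - (1 - 1).
  rewrite subrr subr0 -qE Phi_lt ltr_pdivlMr// /b /eta /L; lra.
near (0 : R)^'+ => d.
have d0 : 0 < d by near: d; exact: nbhs_right_gt.
have h1 : 2 * eta - 2 * W d * q1 < L + rho by near: d; exact: (cvgr_lt _ cc1).
have h2 : Phi q1 < eps * Phi (eta / d) by near: d; exact: (cvgr_gt _ cc2).
have h3 : eps < Phi (- (b + eta) / W d) - (1 - Phi (eta / d)).
  by near: d; exact: (cvgr_gt _ cc3).
pose g := Num.min (eps * Phi (eta / d) - Phi q1)
  (Phi (- (b + eta) / W d) - (1 - Phi (eta / d)) - eps).
have g0 : 0 < g by rewrite lt_min !subr_gt0 h2.
(* [X <= sqrt n] makes the smoothing width at least 1 and the error less than [g] *)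
pose X := Num.max (d^-1) ((K + 1) / (d ^+ 3 * g)).
have X0 : 0 < X by rewrite lt_max invr_gt0 d0.
near=> n.
have nX : X ^+ 2 <= n%:R by near: n; exact: nbhs_infty_ger.
have n0 : 0 < n%:R :> R by apply: lt_le_trans nX; rewrite exprn_gt0.
set N := Num.sqrt n%:R : R.
have N0 : 0 < N by rewrite sqrtr_gt0.
have XN : X <= N by rewrite -[leLHS](ger0_norm (ltW X0)) -sqrtr_sqr ler_wsqrtr.
have dN : 1 <= d * N.
  rewrite mulrC -ler_pdivrMr// mul1r; apply: le_trans XN.
  by rewrite le_max lexx.
have errg : K / (d ^+ 3 * N) < g.
  have d3 : 0 < d ^+ 3 by rewrite exprn_gt0.
  have : (K + 1) / (d ^+ 3 * g) <= N by apply: le_trans XN; rewrite le_max lexx orbT.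
  rewrite ler_pdivrMr ?mulr_gt0// => hN.
  rewrite ltr_pdivrMr ?mulr_gt0//; lra.
have [g1 g2] : g <= eps * Phi (eta / d) - Phi q1 /\
    g <= Phi (- (b + eta) / W d) - (1 - Phi (eta / d)) - eps.
  by split; rewrite ge_min lexx ?orbT.
have [ne low] : body_dists n eps !=set0 /\ 2 * b * N <= max_dist n eps.
  by apply: (max_dist_lower hK d0 dN eps0 (eta := eta)); rewrite -/N -/(W d); lra.
have up : max_dist n eps <= N * (2 * eta - 2 * W d * q1).
  apply: ge_sup => // r hr.
  by apply: (body_dists_upper hK d0 dN eps0 eta0 q10) hr; rewrite -/N; lra.
rewrite ler_distl lerBlDr; apply/andP; split.
  rewrite ler_pdivrMr//; apply: le_trans up _.
  by rewrite mulrC ler_wpM2r ?(ltW N0)// ltW.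
rewrite -lerBlDr ler_pdivlMr//; apply: le_trans low.
by rewrite /b mulrCA divff ?mulr1.
Unshelve. all: by end_near. Qed.

End limits.

(** * The quantile near zero *)

Section quantile.
Context {R : realType}.

Lemma quantile_ratio_bounds (a : R) : 1 <= a ->
  a / (a + 1) <= Num.sqrt pi * a / Num.sqrt (- ln (Phi (- a))) <= 1.
Proof.
move=> a1.
have a0 : 0 < a by exact: lt_le_trans a1.
have p0 : 0 < pi :> R := pi_gt0 R.
have P0 := Phi_gt0 (- a).
have up : pi * a ^+ 2 <= - ln (Phi (- a)).
  rewrite lerNr -[leRHS]expRK ler_ln ?posrE ?expR_gt0// -mulNr.
  exact: Phi_tail_upper.
have low : - ln (Phi (- a)) <= pi * (a + 1) ^+ 2.
  rewrite lerNl -[leLHS]expRK ler_ln ?posrE ?expR_gt0// -mulNr.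
  by apply: Phi_tail_lower; exact: ltW.
have sq (c : R) : 0 <= c -> Num.sqrt (pi * c ^+ 2) = Num.sqrt pi * c.
  by move=> c0; rewrite sqrtrM ?pi_ge0// sqrtr_sqr ger0_norm.
have sp : 0 < Num.sqrt pi :> R by rewrite sqrtr_gt0.
have s1 : Num.sqrt pi * a <= Num.sqrt (- ln (Phi (- a))).
  by rewrite -sq ?(ltW a0)//; exact: ler_wsqrtr.
have s2 : Num.sqrt (- ln (Phi (- a))) <= Num.sqrt pi * (a + 1).
  by rewrite -sq; [exact: ler_wsqrtr | lra].
have D0 : 0 < Num.sqrt (- ln (Phi (- a))) by apply: lt_le_trans s1; rewrite mulr_gt0.
apply/andP; split; last by rewrite ler_pdivrMr// mul1r.
rewrite ler_pdivlMr// mulrAC ler_pdivrMr; last lra.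
by rewrite mulrAC [leRHS]mulrC ler_wpM2l// ltW.
Qed.

Lemma quantile_equivalent :
  ((- 2 * Num.sqrt (pi / 6) * Phi_inv eps)
     / (2 / Num.sqrt 6 * Num.sqrt (- ln eps))) @[eps --> (0 : R)^'+] --> (1 : R).
Proof.
apply/cvgrPdist_le => e e0.
near=> eps.
have eps0 : 0 < eps by near: eps; exact: nbhs_right_gt.
have eps1 : eps < 1 by near: eps; exact: nbhs_right_lt.
pose M : R := e^-1 + 1.
have i0 : 0 < e^-1 by rewrite invr_gt0.
have epsM : eps < Phi (- M) by near: eps; apply: nbhs_right_lt; exact: Phi_gt0.
have qE : Phi (Phi_inv eps) = eps by apply: Phi_invK; rewrite eps0.
set a := - Phi_inv eps.
have qa : Phi_inv eps = - a by rewrite /a opprK.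
have aM : M < a.
  by move: epsM; rewrite -qE Phi_lt -/a qa ltrN2.
have a1 : 1 <= a by rewrite /M in aM; lra.
have := quantile_ratio_bounds a1.
rewrite -qa qE => /andP[h1 h2].
rewrite (_ : _ / (_ * _) = Num.sqrt pi * a / Num.sqrt (- ln eps)); last first.
  rewrite qa sqrtrM ?pi_ge0// sqrtrV//.
  have s6 : Num.sqrt 6 != 0 :> R by rewrite gt_eqF// sqrtr_gt0.
  have D0 : 0 < Num.sqrt (- ln eps) by rewrite sqrtr_gt0 oppr_gt0 ln_lt0// eps0.
  move: (Num.sqrt 6) s6 (Num.sqrt (- ln eps)) D0 (Num.sqrt pi) => s s6 D D0 p.
  by field; rewrite s6 gt_eqF.
rewrite ger0_norm ?subr_ge0//.
have : 1 - e <= a / (a + 1).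
  rewrite ler_pdivlMr; last lra.
  have : 1 <= e * a.
    rewrite mulrC -ler_pdivrMr// mul1r.
    by rewrite /M in aM; lra.
  lra.
lra.
Unshelve. all: by end_near. Qed.

End quantile.

Theorem theorem7p3 (R : realType) :
  (forall eps : R, 0 < eps < 2^-1 ->
    (max_dist n eps / Num.sqrt n%:R) @[n --> \oo]
      --> - 2 * Num.sqrt (pi / 6) * Phi_inv eps)
  /\
  ((- 2 * Num.sqrt (pi / 6) * Phi_inv eps)
     / (2 / Num.sqrt 6 * Num.sqrt (- ln eps))) @[eps --> (0 : R)^'+] --> (1 : R).
Proof. by split; [exact: max_dist_cvg | exact: quantile_equivalent]. Qed.
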